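(* Let $\mathcal{P}$ be one of the ring properties: semiprimary; right perfect; $\pi$-regular and semiperfect; $\pi$-regular. Then the inverse limit of a small category of pro-$\mathcal{P}$ rings is strictly pro-$\mathcal{P}$.
   Context: All rings are unital and ring homomorphisms preserve the unity. A small category $\mathscr{C}$ of pro-$\mathcal{P}$ rings has as objects topological rings $\{R_i\}_{i\in I}$ that are pro-$\mathcal{P}$, and as morphisms continuous ring homomorphisms; its inverse limit is the ring of tuples $(x_i)_{i\in I}\in\prod_{i\in I}R_i$ such that $f(x_j)=x_i$ for all $i,j\in I$ and $f\in\mathrm{Hom}_{\mathscr{C}}(R_j,R_i)$, with the topology induced from the product topology. A topological ring $R$ is pro-$\mathcal{P}$ if it is isomorphic, as a topological ring, to the inverse limit of an inverse system (indexed by a directed set, transition maps not assumed onto) of discrete rings satisfying $\mathcal{P}$; it is strictly pro-$\mathcal{P}$ if this can be done so that in addition the standard map from $R$ to each ring in the system is onto. A ring is $\pi$-regular if for every element $a$ the chain $aR\supseteq a^2R\supseteq\cdots$ stabilizes; semilocal if $R/\mathrm{Jac}(R)$ is semisimple artinian; semiperfect if semilocal and idempotents lift modulo $\mathrm{Jac}(R)$; semiprimary if semilocal with $\mathrm{Jac}(R)$ nilpotent; right perfect if semilocal and for every sequence $x_1,x_2,\dots\in\mathrm{Jac}(R)$ the sequence $x_1,x_2x_1,x_3x_2x_1,\dots$ eventually vanishes. *)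

(* Defs.v *)
From HB Require Import structures.
From mathcomp Require Import all_boot all_algebra generic_quotient.
From mathcomp Require Import all_classical topology tvs.

Set Implicit Arguments.
Unset Strict Implicit.
Unset Printing Implicit Defensive.

Import GRing.Theory.

Local Open Scope classical_set_scope.
Local Open Scope ring_scope.
Local Open Scope quotient_scope.

(* Rings are [pzRingType]s: unital, not necessarily commutative, and the zero
   ring is allowed (it is the limit of the empty category). *)

Section Ideals.
Variable R : pzRingType.
Implicit Types I J K M : set R.

Definition right_ideal I :=
  [/\ I 0, forall x y, I x -> I y -> I (x - y) & forall x r, I x -> I (x * r)].

Definition maximal_right_ideal M :=
  [/\ right_ideal M, M <> setT
    & forall I, right_ideal I -> M `<=` I -> I = M \/ I = setT].

Definition Jac : set R := \bigcap_(M in maximal_right_ideal) M.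

Definition nilpotent J := exists n : nat, forall x : 'I_n -> R,
  (forall i, J (x i)) -> \prod_(i < n) x i = 0.

(* The right module R_R is semisimple and artinian; by Wedderburn-Artin the
   conjunction is left-right symmetric. *)
Definition semisimple := forall I, right_ideal I ->
  exists K, [/\ right_ideal K, I `&` K = [set 0]
    & [set x + y | x in I & y in K] = setT].

Definition right_artinian := forall I : nat -> set R,
  (forall n, right_ideal (I n)) -> (forall n, I n.+1 `<=` I n) ->
  exists n, forall m, (n <= m)%N -> I m = I n.

Lemma right_ideal_Jac : right_ideal Jac.
Proof.
split=> [M [[]]//|x y Jx Jy M mM|x r Jx M mM].
  by have [[_ MB _] _ _] := mM; apply: MB; [exact: Jx|exact: Jy].
by have [[_ _ MM] _ _] := mM; apply: MM; exact: Jx.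
Qed.

Lemma Jac_mulr r x : Jac x -> Jac (r * x).
Proof.
move=> Jx M mM; have [iM nM maxM] := mM; have [M0 MB MM] := iM.
have MN y : M y -> M (- y) by move=> My; rewrite -[- y]add0r; exact: MB.
have MD y z : M y -> M z -> M (y + z).
  by move=> My Mz; rewrite -[z]opprK; apply: MB => //; exact: MN.
case: (pselect (M r)) => [Mr|nMr]; first exact: MM.
have genM a : ~ M a -> exists m s, M m /\ r = m + a * s.
  move=> nMa; pose I := [set z | exists m s, M m /\ z = m + a * s].
  have iI : right_ideal I.
    split=> [|_ _ [m [s [Mm ->]]] [m' [s' [Mm' ->]]]|_ t [m [s [Mm ->]]]].
    - by exists 0, 0; rewrite mulr0 addr0.
    - exists (m - m'), (s - s'); split; first exact: MB.
      by rewrite mulrBr opprD addrACA.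
    - exists (m * t), (s * t); split; first exact: MM.
      by rewrite mulrDl mulrA.
  have MI : M `<=` I by move=> m Mm; exists m, 0; rewrite mulr0 addr0.
  case: (maxM I iI MI) => IE; last by have : I r by rewrite IE.
  by case: nMa; rewrite -IE; exists 0, 1; rewrite mulr1 add0r.
suff : maximal_right_ideal [set y | M (r * y)] by move/Jx.
split.
- split=> [|y z /= My Mz|y s /= My]; rewrite /= ?mulr0 ?mulrBr ?mulrA//.
  + exact: MB.
  + exact: MM.
- by move=> /(congr1 (fun A => A 1)) /=; rewrite mulr1 => E; apply: nMr; rewrite E.
move=> N [N0 NB NM] sN.
case: (pselect (N `<=` [set y | M (r * y)])) => [Ns|]; first by left; apply/seteqP.
move=> /existsNP[n /not_implyP[Nn nMn]]; right.
have [m [s [Mm rE]]] := genM _ nMn.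
have N1s : N (1 - n * s) by apply: sN; rewrite /= mulrBr mulr1 mulrA {1}rE addrK.
have N1 : N 1.
  have -> : 1 = 1 - n * s - (0 - n * s) by rewrite sub0r opprK subrK.
  by apply: (NB) => //; apply: (NB) => //; exact: NM.
by apply/seteqP; split=> // y _; rewrite -[y]mul1r; exact: NM.
Qed.

End Ideals.

Arguments Jac : clear implicits.
Arguments semisimple : clear implicits.
Arguments right_artinian : clear implicits.

(* [modJ R] is R / Jac(R); [ring_quotient] is restricted to proper ideals of
   commutative rings. *)
Section QuotientByJac.
Variable R : pzRingType.

Definition eqmodJ : rel R := fun x y => `[< Jac R (x - y) >].

Lemma JacN (x : R) : Jac R x -> Jac R (- x).
Proof.
have [J0 JB _] := right_ideal_Jac R.
by move=> Jx; rewrite -[- x]add0r; exact: JB.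
Qed.

Lemma JacD (x y : R) : Jac R x -> Jac R y -> Jac R (x + y).
Proof.
have [_ JB _] := right_ideal_Jac R.
by move=> Jx Jy; rewrite -[y]opprK; apply: JB => //; exact: JacN.
Qed.

Lemma eqmodJ_equiv : equiv_class_of eqmodJ.
Proof.
have [J0 JB _] := right_ideal_Jac R.
split=> [x|x y|y x z /asboolP xy /asboolP yz].
- by apply/asboolP; rewrite subrr.
- by apply: asbool_equiv_eq; split=> /JacN; rewrite opprB.
- by apply/asboolP; have := JacD xy yz; rewrite addrA subrK.
Qed.

Canonical eqmodJ_equiv_rel := EquivRelPack eqmodJ_equiv.

Definition modJ := {eq_quot eqmodJ}.

HB.instance Definition _ := Choice.on modJ.
HB.instance Definition _ := EqQuotient.on modJ.

Definition modJ_add := lift_op2 modJ +%R.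
Definition modJ_opp := lift_op1 modJ -%R.
Definition modJ_mul := lift_op2 modJ *%R.
Definition modJ_zero : modJ := lift_cst modJ 0.
Definition modJ_one : modJ := lift_cst modJ 1.

Canonical pi_modJ_zero := PiConst modJ_zero.
Canonical pi_modJ_one := PiConst modJ_one.

Lemma eqmodP (x y : R) : reflect (Jac R (x - y)) (x == y %[mod modJ]).
Proof. by rewrite piE; exact: asboolP. Qed.

Lemma pi_modJ_opp : {morph \pi_modJ : x / - x >-> modJ_opp x}.
Proof.
move=> x; unlock modJ_opp; apply/eqP/eqmodP.
by rewrite -opprD; apply: JacN; apply/eqmodP; rewrite reprK.
Qed.
Canonical pi_modJ_opp_morph := PiMorph1 pi_modJ_opp.

Lemma pi_modJ_add : {morph \pi_modJ : x y / x + y >-> modJ_add x y}.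
Proof.
move=> x y; unlock modJ_add; apply/eqP/eqmodP.
rewrite opprD addrACA; apply: JacD;
  by apply/eqmodP; rewrite reprK.
Qed.
Canonical pi_modJ_add_morph := PiMorph2 pi_modJ_add.

Lemma pi_modJ_mul : {morph \pi_modJ : x y / x * y >-> modJ_mul x y}.
Proof.
have [_ _ JM] := right_ideal_Jac R.
move=> x y; unlock modJ_mul; apply/eqP/eqmodP.
set x' := repr _; set y' := repr _.
have -> : x * y - x' * y' = (x - x') * y + x' * (y - y').
  by rewrite mulrBl mulrBr addrA subrK.
apply: JacD.
  by apply: JM; apply/eqmodP; rewrite reprK.
by apply: Jac_mulr; apply/eqmodP; rewrite reprK.
Qed.
Canonical pi_modJ_mul_morph := PiMorph2 pi_modJ_mul.

Lemma modJ_addA : associative modJ_add.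
Proof. by move=> x y z; rewrite -[x]reprK -[y]reprK -[z]reprK !piE addrA. Qed.
Lemma modJ_addC : commutative modJ_add.
Proof. by move=> x y; rewrite -[x]reprK -[y]reprK !piE addrC. Qed.
Lemma modJ_add0 : left_id modJ_zero modJ_add.
Proof. by move=> x; rewrite -[x]reprK !piE add0r. Qed.
Lemma modJ_addN : left_inverse modJ_zero modJ_opp modJ_add.
Proof. by move=> x; rewrite -[x]reprK !piE addNr. Qed.
Lemma modJ_mulA : associative modJ_mul.
Proof. by move=> x y z; rewrite -[x]reprK -[y]reprK -[z]reprK !piE mulrA. Qed.
Lemma modJ_mul1 : left_id modJ_one modJ_mul.
Proof. by move=> x; rewrite -[x]reprK !piE mul1r. Qed.
Lemma modJ_1mul : right_id modJ_one modJ_mul.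
Proof. by move=> x; rewrite -[x]reprK !piE mulr1. Qed.
Lemma modJ_mulDl : left_distributive modJ_mul modJ_add.
Proof. by move=> x y z; rewrite -[x]reprK -[y]reprK -[z]reprK !piE mulrDl. Qed.
Lemma modJ_mulDr : right_distributive modJ_mul modJ_add.
Proof. by move=> x y z; rewrite -[x]reprK -[y]reprK -[z]reprK !piE mulrDr. Qed.

HB.instance Definition _ := GRing.isPzRing.Build modJ
  modJ_addA modJ_addC modJ_add0 modJ_addN
  modJ_mulA modJ_mul1 modJ_1mul modJ_mulDl modJ_mulDr.

Lemma pi_modJ_is_zmod_morphism : zmod_morphism (\pi_modJ : R -> modJ).
Proof. by move=> x y; rewrite !piE. Qed.
Lemma pi_modJ_is_monoid_morphism : monoid_morphism (\pi_modJ : R -> modJ).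
Proof. by split=> [|x y]; rewrite !piE. Qed.

HB.instance Definition _ := GRing.isZmodMorphism.Build R modJ
  (\pi_modJ : R -> modJ) pi_modJ_is_zmod_morphism.
HB.instance Definition _ := GRing.isMonoidMorphism.Build R modJ
  (\pi_modJ : R -> modJ) pi_modJ_is_monoid_morphism.

End QuotientByJac.

Arguments modJ : clear implicits.

Section RingProperties.
Variable R : pzRingType.

Definition pi_regular := forall a : R, exists2 n, (0 < n)%N &
  forall m, (n <= m)%N -> range (fun r => a ^+ m * r) = range (fun r => a ^+ n * r).

Definition semilocal := semisimple (modJ R) /\ right_artinian (modJ R).

Definition idempotents_lift := forall u : modJ R, u * u = u ->
  exists2 e : R, e * e = e & \pi_(modJ R) e = u.

Definition semiperfect := semilocal /\ idempotents_lift.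

Definition semiprimary := semilocal /\ nilpotent (Jac R).

(* [lprod x n] is x_{n-1} ... x_1 x_0. *)
Fixpoint lprod (x : nat -> R) (n : nat) : R :=
  if n is n'.+1 then x n' * lprod x n' else 1.

Definition right_perfect := semilocal /\
  forall x : nat -> R, (forall n, Jac R (x n)) ->
  exists N, forall n, (N <= n)%N -> lprod x n.+1 = 0.

Definition pi_regular_semiperfect := pi_regular /\ semiperfect.

End RingProperties.

HB.mixin Record TopologicalZmodule_isTopologicalPzRing R
    & TopologicalZmodule R & GRing.PzRing R := {
  mul_continuous : continuous (fun x : R * R => x.1 * x.2) ;
}.

#[short(type="topologicalPzRingType")]
HB.structure Definition TopologicalPzRing :=
  {R of TopologicalZmodule R & GRing.PzRing R
        & TopologicalZmodule_isTopologicalPzRing R}.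

Definition top_ring_iso (R S : topologicalPzRingType) (f : {rmorphism R -> S}) :=
  exists g : S -> R, [/\ cancel f g, cancel g f, continuous f & continuous g].

(* [hom j i] is the set of morphisms from [ob j] to [ob i]. *)
Record small_category := SmallCategory {
  idx : Type;
  ob :> idx -> topologicalPzRingType;
  hom : forall j i, set (ob j -> ob i);
  hom_id : forall i, @hom i i idfun;
  hom_comp : forall k j i g f, @hom k j g -> @hom j i f -> @hom k i (f \o g);
  hom_zmod_morphism : forall j i f, @hom j i f -> zmod_morphism f;
  hom_monoid_morphism : forall j i f, @hom j i f -> monoid_morphism f;
  hom_continuous : forall j i f, @hom j i f -> continuous f
}.
Arguments hom : clear implicits.

Section ProductRing.
Variables (I : Type) (T : I -> topologicalPzRingType).
Local Notation P := (prod_topology T).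

Let addA : associative (fun x y : P => (fun i => x i + y i) : P).
Proof. by move=> x y z; apply: functional_extensionality_dep => i; rewrite addrA. Qed.
Let addC : commutative (fun x y : P => (fun i => x i + y i) : P).
Proof. by move=> x y; apply: functional_extensionality_dep => i; rewrite addrC. Qed.
Let add0 : left_id ((fun i => 0) : P) (fun x y : P => (fun i => x i + y i) : P).
Proof. by move=> x; apply: functional_extensionality_dep => i; rewrite add0r. Qed.
Let addN : left_inverse ((fun i => 0) : P) (fun x : P => (fun i => - x i) : P)
  (fun x y : P => (fun i => x i + y i) : P).
Proof. by move=> x; apply: functional_extensionality_dep => i; rewrite addNr. Qed.
Let mulA : associative (fun x y : P => (fun i => x i * y i) : P).
Proof. by move=> x y z; apply: functional_extensionality_dep => i; rewrite mulrA. Qed.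
Let mul1 : left_id ((fun i => 1) : P) (fun x y : P => (fun i => x i * y i) : P).
Proof. by move=> x; apply: functional_extensionality_dep => i; rewrite mul1r. Qed.
Let mulx1 : right_id ((fun i => 1) : P) (fun x y : P => (fun i => x i * y i) : P).
Proof. by move=> x; apply: functional_extensionality_dep => i; rewrite mulr1. Qed.
Let mulDl : left_distributive (fun x y : P => (fun i => x i * y i) : P)
  (fun x y : P => (fun i => x i + y i) : P).
Proof. by move=> x y z; apply: functional_extensionality_dep => i; rewrite mulrDl. Qed.
Let mulDr : right_distributive (fun x y : P => (fun i => x i * y i) : P)
  (fun x y : P => (fun i => x i + y i) : P).
Proof. by move=> x y z; apply: functional_extensionality_dep => i; rewrite mulrDr. Qed.

HB.instance Definition _ := GRing.isPzRing.Build P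
  addA addC add0 addN mulA mul1 mulx1 mulDl mulDr.

End ProductRing.

Section InverseLimit.
Variable C : small_category.

Definition compatible : set (prod_topology (@ob C)) :=
  [set x | forall j i (f : C j -> C i), hom C j i f -> f (x j) = x i].

Definition inv_lim : Type := set_type compatible.

HB.instance Definition _ := SubChoice.on inv_lim.
HB.instance Definition _ := Topological.on inv_lim.

Lemma compatible_subring : subring_closed (mem compatible).
Proof.
split=> [|x y /set_mem cx /set_mem cy|x y /set_mem cx /set_mem cy];
  apply/mem_set => j i f hf.
- by have [f1 _] := hom_monoid_morphism hf.
- by rewrite [LHS](hom_zmod_morphism hf) (cx _ _ _ hf) (cy _ _ _ hf).
- have [_ fM] := hom_monoid_morphism hf.
  by rewrite [LHS]fM (cx _ _ _ hf) (cy _ _ _ hf).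
Qed.

HB.instance Definition _ := GRing.SubChoice_isSubPzRing.Build
  (prod_topology (@ob C)) (mem compatible) inv_lim compatible_subring.

Definition lim_proj (i : idx C) (x : inv_lim) : C i := \val x i.

Lemma lim_proj_continuous i : continuous (@lim_proj i).
Proof.
move=> x; apply: (@continuous_comp inv_lim (prod_topology (@ob C)) _
  \val (fun y => y i)); first exact: (@initial_continuous inv_lim).
by have /cvg_sup/(_ i) h : \val x --> (\val x : prod_topology (@ob C));
  [exact: cvg_id | apply: cvg_trans (@initial_continuous _ _ (fun f => f i) _);
  exact: cvg_app].
Qed.

Lemma continuous_lim (X : topologicalType) (f : X -> inv_lim) :
  (forall i, continuous (lim_proj i \o f)) -> continuous f.
Proof.
move=> cf; apply: (@continuous_comp_initial inv_lim _ (prod_topology (@ob C))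
  (\val : inv_lim -> prod_topology (@ob C))) => x.
apply/cvg_sup => i.
exact: (@continuous_comp_initial _ _ _ (fun g : prod_topology (@ob C) => g i)
  _ (cf i)).
Qed.

Lemma lim_add_continuous : continuous (fun x : inv_lim * inv_lim => x.1 + x.2).
Proof.
apply: continuous_lim => i x.
apply: (@cvg_comp _ _ _ (fun z : inv_lim * inv_lim =>
  (lim_proj i z.1, lim_proj i z.2)) (fun z => z.1 + z.2)); last first.
  exact: (@add_continuous (C i) (lim_proj i x.1, lim_proj i x.2)).
by apply: cvg_pair; [apply: (cvg_comp _ _ cvg_fst) | apply: (cvg_comp _ _ cvg_snd)];
  exact: lim_proj_continuous.
Qed.

Lemma lim_opp_continuous : continuous (-%R : inv_lim -> inv_lim).
Proof.
apply: continuous_lim => i x.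
apply: (@cvg_comp _ _ _ (lim_proj i) -%R); first exact: lim_proj_continuous.
exact: (@opp_continuous (C i) (lim_proj i x)).
Qed.

Lemma lim_mul_continuous : continuous (fun x : inv_lim * inv_lim => x.1 * x.2).
Proof.
apply: continuous_lim => i x.
apply: (@cvg_comp _ _ _ (fun z : inv_lim * inv_lim =>
  (lim_proj i z.1, lim_proj i z.2)) (fun z => z.1 * z.2)); last first.
  exact: (@mul_continuous (C i) (lim_proj i x.1, lim_proj i x.2)).
by apply: cvg_pair; [apply: (cvg_comp _ _ cvg_fst) | apply: (cvg_comp _ _ cvg_snd)];
  exact: lim_proj_continuous.
Qed.

HB.instance Definition _ :=
  PreTopologicalNmodule_isTopologicalNmodule.Build inv_lim lim_add_continuous.
HB.instance Definition _ :=
  TopologicalNmodule_isTopologicalZmodule.Build inv_lim lim_opp_continuous.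
HB.instance Definition _ :=
  TopologicalZmodule_isTopologicalPzRing.Build inv_lim lim_mul_continuous.

End InverseLimit.

Record directed_set := DirectedSet {
  dset :> Type;
  dle : dset -> dset -> Prop;
  dle_refl : forall i, dle i i;
  dle_trans : forall i j k, dle i j -> dle j k -> dle i k;
  dset_inhabited : exists i : dset, True;
  dset_directed : forall i j, exists2 k, dle i k & dle j k
}.

Record inverse_system := InverseSystem {
  sys_idx : directed_set;
  sys_ob :> sys_idx -> topologicalPzRingType;
  trmap : forall i j, dle i j -> sys_ob j -> sys_ob i;
  trmap_id : forall i (h : dle i i) x, trmap h x = x;
  trmap_comp : forall i j k (hij : dle i j) (hjk : dle j k) (hik : dle i k) x,
    trmap hij (trmap hjk x) = trmap hik x;
  trmap_zmod_morphism : forall i j (h : dle i j), zmod_morphism (trmap h);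
  trmap_monoid_morphism : forall i j (h : dle i j), monoid_morphism (trmap h);
  trmap_continuous : forall i j (h : dle i j), continuous (trmap h)
}.

Section SystemCategory.
Variable S : inverse_system.

Definition sys_hom (j i : sys_idx S) : set (S j -> S i) :=
  [set f | exists h : dle i j, f = trmap h].

Lemma sys_hom_id i : @sys_hom i i idfun.
Proof.
exists (dle_refl i).
by apply: functional_extensionality_dep => x; rewrite trmap_id.
Qed.

Lemma sys_hom_comp k j i g f :
  @sys_hom k j g -> @sys_hom j i f -> @sys_hom k i (f \o g).
Proof.
move=> [hjk ->] [hij ->]; exists (dle_trans hij hjk).
by apply: functional_extensionality_dep => x; exact: trmap_comp.
Qed.

Lemma sys_hom_zmod_morphism j i f : @sys_hom j i f -> zmod_morphism f.
Proof. by move=> [h ->]; exact: trmap_zmod_morphism. Qed.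

Lemma sys_hom_monoid_morphism j i f : @sys_hom j i f -> monoid_morphism f.
Proof. by move=> [h ->]; exact: trmap_monoid_morphism. Qed.

Lemma sys_hom_continuous j i f : @sys_hom j i f -> continuous f.
Proof. by move=> [h ->]; exact: trmap_continuous. Qed.

Definition sys_cat : small_category := SmallCategory sys_hom_id sys_hom_comp
  sys_hom_zmod_morphism sys_hom_monoid_morphism sys_hom_continuous.

End SystemCategory.

Definition discrete (X : topologicalType) := forall A : set X, open A.

Section ProP.
Variable P : pzRingType -> Prop.
Implicit Type R : topologicalPzRingType.

Definition pro R := exists S : inverse_system,
  [/\ forall i, discrete (S i), forall i, P (S i)
    & exists f : {rmorphism R -> inv_lim (sys_cat S)}, top_ring_iso f].

Definition strictly_pro R := exists S : inverse_system,
  [/\ forall i, discrete (S i), forall i, P (S i)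
    & exists2 f : {rmorphism R -> inv_lim (sys_cat S)}, top_ring_iso f
      & forall i, range (fun x => @lim_proj (sys_cat S) i (f x)) = setT].

End ProP.

(* Main.v *)
(** Idea. Every ring in the four classes is strongly pi-regular, i.e. each
    element has a Drazin inverse (Dischinger's theorem; for right perfect rings
    T-nilpotence first gives [a ^+ m = q * a ^+ m.+1]). Drazin inverses are
    unique and preserved by ring morphisms, so the limit [R] of the category,
    embedded in the product of all the discrete rings [D a] involved, is closed
    under componentwise Drazin inverses, and the same holds for its image [Q]
    in each finite subproduct. The images [Q] form a system of discrete rings
    with limit [R] and surjective projections, so it suffices that [Q] inherits
    the property. If the [D a] are semilocal, [Q] has no infinite family of
    orthogonal idempotents, which together with Drazin inverses makes [Q]
    semiperfect with [Jac Q] nil. By Levitzki's argument the image of [Jac Q]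
    in the semisimple ring [modJ (D a)] is nilpotent, so some power of [Jac Q]
    lands in each [Jac (D a)], which transfers nilpotence and T-nilpotence. *)

Require Import Defs.
From HB Require Import structures.
From mathcomp Require Import all_boot all_algebra generic_quotient.
From mathcomp Require Import all_classical topology tvs.

Set Implicit Arguments.
Unset Strict Implicit.
Unset Printing Implicit Defensive.

Import GRing.Theory.

Local Open Scope classical_set_scope.
Local Open Scope ring_scope.
Local Open Scope quotient_scope.

(** * Drazin inverses *)

Definition drazin (R : pzRingType) (a b : R) :=
  [/\ a * b = b * a, b * a * b = b & exists k, a ^+ k.+1 * b = a ^+ k].

Section Drazin.
Variable R : pzRingType.
Implicit Types a b c : R.

Lemma drazin_index a b k n :
  a ^+ k.+1 * b = a ^+ k -> (k <= n)%N -> a ^+ n.+1 * b = a ^+ n.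
Proof. by move=> h /subnK <-; rewrite -addnS !exprD -mulrA h. Qed.

Lemma drazin_idem a b : drazin a b -> a * b * (a * b) = a * b.
Proof. by case=> _ bab _; rewrite -mulrA (mulrA b) bab. Qed.

Lemma drazin_idemX a b n : drazin a b -> (a * b) ^+ n.+1 = a * b.
Proof.
by move=> hab; elim: n => [|n IHn]; rewrite ?expr1// exprS IHn drazin_idem.
Qed.

(** Each of the idempotents [a * b] and [a * c] contains an arbitrarily high power of [a] as a
    factor, on which the other acts as the identity. Hence [a * b = a * b * (a * c) = a * c], and
    [b = c] follows. *)
Lemma drazin_uniq a b c : drazin a b -> drazin a c -> b = c.
Proof.
move=> hb hc; have [ab bab [k hk]] := hb; have [ac cac [l hl]] := hc.
have ab_c : a * b * (a * c) = a * b.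
  have E : a * b = b ^+ l.+1 * a ^+ l.+1.
    by rewrite -(drazin_idemX l hb) ab exprMn_comm.
  by rewrite E -mulrA (mulrA _ a) -exprSr (drazin_index hl).
have b_ac : a * b * (a * c) = a * c.
  have E : a * c = a ^+ k.+1 * c ^+ k.+1.
    by rewrite -(drazin_idemX k hc) exprMn_comm.
  rewrite E mulrA ab -(mulrA b) -exprS (commrX k.+2 (esym ab) : _ = _).
  by rewrite (drazin_index hk).
have eq_ab : a * b = a * c by rewrite -ab_c.
by rewrite -bab -mulrA eq_ab mulrA -ab eq_ab ac cac.
Qed.

(** The idempotent [g = s * a] commutes with [c], since [g * c] and [c * g] both equal [g * c * g];
    then [s * c = s * c * g = s * a * c * s = c * s]. *)
Lemma group_inverse_comm a s c : a * s = s * a -> s * a * s = s ->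
  a * s * a = a -> GRing.comm a c -> GRing.comm s c.
Proof.
move=> as_ sas asa ac; have caE : a * c = c * a by [].
have saa : s * a * a = a by rewrite -as_ asa.
have aas : a * (a * s) = a by rewrite as_ mulrA asa.
have gc : s * a * c = s * a * c * (a * s).
  by rewrite -(mulrA s) caE -!mulrA aas.
have cg : c * (a * s) = s * a * c * (a * s).
  by rewrite (mulrA c) -caE -(mulrA (s * a)) (mulrA c) -caE !mulrA saa.
have sg : s * (a * s) = s by rewrite mulrA.
have gs : a * s * s = s by rewrite as_ sas.
have {gc cg} gcE : s * a * c = c * (a * s) by rewrite gc -cg.
rewrite /GRing.comm -{1}sg as_ -mulrA gcE (mulrA c) -caE !mulrA.
by rewrite gcE -mulrA gs.
Qed.

(* The element [y := c - a] satisfies [a * y = 0]; applying pi-regularity to [y]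
   gives [b * b * y = b * y * w], hence [a - a * b * a = a * b * y = a * y * w = 0]. *)
Lemma square_absorb a b c :
  (forall x : R, exists n y, x ^+ n = x ^+ n.+1 * y) ->
  a * a * b = a -> b * b * c = b -> a * b * a = a.
Proof.
move=> piR aab bbc.
have abc : a * b * c = a by rewrite -{1}aab -!mulrA (mulrA b) bbc mulrA aab.
have ac : a * c = a * a by rewrite -{3}abc !mulrA aab.
pose y := c - a; have ay : a * y = 0 by rewrite mulrBr ac subrr.
have yX n : y ^+ n.+1 = c ^+ n * y.
  elim: n => [|n IHn]; first by rewrite mul1r.
  by rewrite exprSr IHn exprSr -!mulrA [y * y]mulrBl ay subr0.
have bX n : b ^+ n.+1 * c ^+ n = b.
  elim: n => [|n IHn]; first by rewrite mulr1.
  by rewrite exprS [c ^+ _]exprSr !mulrA -(mulrA b) IHn bbc.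
have [n [w yw]] := piR y.
have bby : b * b * y = b * y * w.
  have /(congr1 (fun t => b ^+ n.+2 * t)) : y ^+ n.+1 = y ^+ n.+2 * w.
    by rewrite exprS yw mulrA -exprS.
  by rewrite !yX !mulrA bX [b ^+ _]exprS -(mulrA b) bX.
have /eqP : a - a * b * a = 0; last by rewrite subr_eq0 => /eqP <-.
transitivity (a * b * y); first by rewrite mulrBr abc.
have <- : a * a * (b * b * y) = a * b * y by rewrite !mulrA aab.
by rewrite bby !mulrA aab ay mul0r.
Qed.

(** In the corner ring with unit [a * b], to which [a] belongs, [s] is a right inverse of [a].
    Pi-regularity at [s] provides [w] with [s * w = a * b], so [s] is right invertible too and is
    inverse to [a] on both sides. *)
Lemma square_group_inverse a b : (forall x : R, exists n y, x ^+ n = x ^+ n.+1 * y) ->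
  a * a * b = a -> a * b * a = a ->
  exists s, [/\ a * s = s * a, s * a * s = s & a * s * a = a].
Proof.
move=> piR aab aba; have [s sE] : exists s, s = a * b * b * (a * b) by eexists.
have as_ : a * s = a * b by rewrite sE !mulrA aab aba.
have abs : a * b * s = s by rewrite sE !mulrA aba.
have sab : s * (a * b) = s by rewrite sE -mulrA (mulrA _ a) aba.
have asX n : a ^+ n.+1 * s ^+ n.+1 = a * b.
  elim: n => [|n IHn]; first by rewrite !expr1.
  rewrite exprSr [s ^+ n.+2]exprS -mulrA (mulrA a) as_ [s ^+ _]exprS (mulrA (a * b)) abs.
  by rewrite -exprS.
move=> {sE}; have [n [w sw]] := piR s.
have swg : s * w = a * b.
  have /(congr1 (fun t => a ^+ n.+1 * t)) : s ^+ n.+1 = s ^+ n.+2 * w.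
    by rewrite exprS sw mulrA -exprS.
  by rewrite asX [s ^+ n.+2]exprSr !mulrA asX abs.
have sa : s * a = a * b.
  by rewrite -{1}aab -(mulrA a) -{1}swg !mulrA -(mulrA s a s) as_ sab.
by exists s; split; rewrite ?sa ?as_.

Qed.

(* Dischinger's theorem: right pi-regularity is left-right symmetric, since the
   notion of Drazin inverse is. *)
Lemma right_pi_regular_drazin : (forall x : R, exists n y, x ^+ n = x ^+ n.+1 * y) ->
  forall a, exists b, drazin a b.
Proof.
move=> piR.
have pow (x : R) : exists n y, x ^+ n.+1 * x ^+ n.+1 * y = x ^+ n.+1.
  have [n [y xy]] := piR x; exists n.
  have xk k : exists z, x ^+ n = x ^+ (k + n) * z.
    elim: k => [|k [z IH]]; first by exists 1; rewrite mulr1.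
    by exists (y * z); rewrite IH exprD {1}xy addSnnS exprD !mulrA.
  have [z zE] := xk n.+1; exists z.
  by rewrite -exprD [in RHS]exprS zE mulrA -exprS addnS.
move=> a; have [n [y AE]] := pow a; have [m [c bE]] := pow y.
(* The exponents make both hypotheses of [square_absorb] available: [AE] yields [P * P * b = P], and
   [bE] is [b * b * c = b]. *)
pose P := a ^+ (n.+1 * m.+1); pose b := y ^+ m.+1.
have PE : P * P * b = P.
  rewrite /P exprM; set A := a ^+ n.+1 in AE *.
  have AX k : A ^+ k.+1 * y ^+ k = A.
    elim: k => [|k IHk]; first by rewrite mulr1.
    by rewrite exprS [y ^+ _]exprSr !mulrA -(mulrA A) IHk AE.
  by rewrite {1}[A ^+ _]exprSr -!mulrA (mulrA A) -exprS AX -exprSr.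
have [s [as_ sas asa]] := square_group_inverse piR PE (square_absorb piR PE bE).
have cas : GRing.comm s a.
  by apply: group_inverse_comm as_ sas asa _; exact/commr_sym/commrX.
have [N PN] : exists N, P = a ^+ N.+1 by exists (n.+1 * m.+1).-1; rewrite prednK.
rewrite {}PN in as_ sas asa {PE}.
have csX : s * a ^+ N = a ^+ N * s := commrX N cas.
have bsa : a ^+ N * s * a = a ^+ N.+1 * s by rewrite -mulrA cas mulrA exprSr.
(* Splitting one factor [a] off [a ^+ N.+1] turns its group inverse [s] into a Drazin inverse of
   [a]. *)
exists (a ^+ N * s); split; first by rewrite bsa mulrA -exprS.
  have aN : a ^+ N.+1 * a ^+ N = a ^+ N * a ^+ N.+1 by rewrite -!exprD addnC.
  by rewrite bsa as_ mulrA -(mulrA s) aN mulrA csX -!mulrA (mulrA s) sas.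
by exists N.+1; rewrite exprSr -mulrA (mulrA a) -exprS as_ mulrA asa.
Qed.

End Drazin.

(** * The Jacobson radical *)

Lemma rmorph_drazin (R S : pzRingType) (f : {rmorphism R -> S}) a b :
  drazin a b -> drazin (f a) (f b).
Proof.
case=> ab bab [k hk]; split; first by rewrite -!rmorphM ab.
  by rewrite -!rmorphM bab.
by exists k; rewrite -!rmorphXn -rmorphM hk.
Qed.

Lemma drazin_pi_regular (R : pzRingType) :
  (forall a : R, exists b, drazin a b) -> pi_regular R.
Proof.
move=> dR a; have [b [_ _ [k hk]]] := dR a.
exists k.+1 => // m km; apply/seteqP; split=> _ [r _ <-].
  by exists (a ^+ (m - k.+1) * r) => //; rewrite mulrA -exprD subnKC.
exists (b ^+ (m - k.+1) * r) => //=; rewrite mulrA; congr (_ * r).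
rewrite -[in a ^+ m](subnKC km).
elim: (m - k.+1)%N => [|n IHn]; first by rewrite addn0 mulr1.
rewrite addnS [b ^+ _]exprS mulrA (drazin_index hk)//.
by rewrite addSn ltnW// ltnS leq_addr.
Qed.

Lemma pi_regular_drazin (R : pzRingType) :
  pi_regular R -> forall a : R, exists b, drazin a b.
Proof.
move=> piR; apply: right_pi_regular_drazin => a.
have [n _ /(_ n.+1 (leqnSn n)) E] := piR a.
have : range (fun r => a ^+ n * r) (a ^+ n) by exists 1; rewrite ?mulr1.
by rewrite -E => -[y _ ay]; exists n, y; rewrite ay.
Qed.

(** Zorn's lemma is applied to the sets whose union with [A0] satisfies [P]: this keeps the result
    above [A0] and makes the empty chain harmless. *)
Lemma Zorn_above (T : Type) (P : set (set T)) (A0 : set T) : P A0 ->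
  (forall F : set (set T), F !=set0 -> F `<=` P -> total_on F subset ->
     P (\bigcup_(X in F) X)) ->
  exists A, [/\ P A, A0 `<=` A & forall B, P B -> A `<=` B -> B = A].
Proof.
move=> PA0 Pchain.
have [F FP Fch|A [PA maxA]] := @Zorn_bigcup T [set B | P (A0 `|` B)].
  have [F0|/set0P F0] := eqVneq F set0.
    by rewrite /= F0 bigcup_set0 setU0.
  rewrite /=; suff -> : A0 `|` \bigcup_(X in F) X =
      \bigcup_(X in [set A0 `|` B | B in F]) X.
    apply: Pchain; first by have [B FB] := F0; exists (A0 `|` B); exists B.
      by move=> _ [B /FP PB <-].
    move=> _ _ [B FB <-] [C FC <-].
    by have [BC|CB] := Fch _ _ FB FC; [left|right]; apply: setUS.
  rewrite bigcup_image; apply/seteqP; split=> x.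
    have [B FB] := F0.
    by case=> [A0x|[C FC Cx]]; [exists B => //; left|exists C => //; right].
  by case=> B FB [A0x|Bx]; [left|right; exists B].
exists (A0 `|` A); split=> // B PB AB; apply: contrapT => nBA.
have A0B : A0 `|` B = B by apply/setUidPr => x A0x; apply: AB; left.
apply: (maxA B); last by rewrite /= A0B.
split; first by move=> x Ax; apply: AB; right.
by move=> BA; apply: nBA; apply/seteqP; split=> // x /BA Ax; right.
Qed.

Section RightIdeals.
Variable R : pzRingType.
Implicit Types (I J K L M : set R) (x y r : R).

Lemma right_idealD I x y : right_ideal I -> I x -> I y -> I (x + y).
Proof.
by move=> [I0 IB _] Ix Iy; rewrite -[y]opprK -[- y]add0r; apply: (IB) => //; exact: IB.
Qed.

Lemma right_idealT I : right_ideal I -> I 1 -> I = setT.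
Proof.
by case=> _ _ IM I1; apply/seteqP; split=> // r _; rewrite -[r]mul1r; exact: IM.
Qed.

Lemma right_ideal_bigcup (F : set (set R)) : F !=set0 ->
  F `<=` @right_ideal R -> total_on F subset -> right_ideal (\bigcup_(X in F) X).
Proof.
move=> [I FI] FP Fch; split.
- by exists I => //; have [] := FP _ FI.
- move=> x y [X FX Xx] [Y FY Yy].
  have [XY|YX] := Fch _ _ FX FY.
    by exists Y => //; have [_ YB _] := FP _ FY; apply: YB => //; exact: XY.
  by exists X => //; have [_ XB _] := FP _ FX; apply: XB => //; exact: YX.
- by move=> x r [X FX Xx]; exists X => //; have [_ _ XM] := FP _ FX; exact: XM.
Qed.

Lemma maximal_right_ideal_above I : right_ideal I -> ~ I 1 ->
  exists2 M, maximal_right_ideal M & I `<=` M.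
Proof.
move=> rI nI1.
have [||M [[rM nM1] IM maxM]] :=
    @Zorn_above _ [set X | right_ideal X /\ ~ X 1] I; first by [].
  move=> F F0 FP Fch; split.
    by apply: right_ideal_bigcup => // X /FP[].
  by case=> X /FP[].
exists M => //; split=> // [MT|J rJ MJ]; first by apply: nM1; rewrite MT.
have [J1|nJ1] := pselect (J 1); first by right; exact: right_idealT.
by left; exact: maxM.
Qed.

Lemma right_ideal_principal x : right_ideal (range (fun r => x * r)).
Proof.
split=> [|_ _ [r _ <-] [s _ <-]|_ s [r _ <-]].
- by exists 0; rewrite ?mulr0.
- by exists (r - s); rewrite ?mulrBr.
- by exists (r * s); rewrite ?mulrA.
Qed.

Lemma Jac_right_inv x : Jac R x -> exists y, (1 - x) * y = 1.
Proof.
move=> Jx; apply: contrapT => ninv.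
have [||M mM sM] := @maximal_right_ideal_above (range (fun r => (1 - x) * r)).
- exact: right_ideal_principal.
- by case=> y _ xy; apply: ninv; exists y.
have [rM nMT _] := mM; apply: nMT; apply: right_idealT => //.
rewrite -(subrK x 1); apply: right_idealD => //; last exact: Jx.
by apply: sM; exists 1; rewrite ?mulr1.
Qed.

(** The right inverse [y] equals [1 + x * y], again [1] minus a radical element, so it has a right
    inverse itself, which must be [1 - x]. *)
Lemma Jac_unit x : Jac R x -> exists y, (1 - x) * y = 1 /\ y * (1 - x) = 1.
Proof.
move=> Jx; have [y xy] := Jac_right_inv Jx; exists y; split=> //.
have [_ _ JM] := right_ideal_Jac R.
have yE : y = 1 - - (x * y) by rewrite -{1}xy mulrBl mul1r opprK subrK.
have [|z yz] := @Jac_right_inv (- (x * y)); first by apply: JacN; exact: JM.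
rewrite -yE in yz.
suff -> : 1 - x = z by [].
by have := congr1 (fun t => t * z) xy; rewrite /= -mulrA yz mulr1 mul1r.
Qed.

(** If [x] lies outside a maximal [M], then [M + x R] is everything, so [M] contains some
    [1 - x * r]; being right invertible, that element forces [M] to be the whole ring. *)
Lemma JacP x : Jac R x <-> forall r, exists y, (1 - x * r) * y = 1.
Proof.
split=> [Jx r|inv M mM].
  by apply: Jac_right_inv; have [_ _ JM] := right_ideal_Jac R; exact: JM.
have [rM nMT maxM] := mM; apply: contrapT => nMx.
pose I := [set m + x * r | m in M & r in [set: R]].
have [M0 MB MM] := rM.
have rI : right_ideal I.
  split=> [|_ _ [m Mm [r _ <-]] [m' Mm' [r' _ <-]]|_ s [m Mm [r _ <-]]].
  - by exists 0 => //; exists 0; rewrite // mulr0 addr0.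
  - exists (m - m'); first exact: MB.
    by exists (r - r') => //; rewrite mulrBr opprD addrACA.
  - exists (m * s); first exact: MM.
    by exists (r * s) => //; rewrite mulrDl mulrA.
have MI : M `<=` I by move=> m Mm; exists m => //; exists 0; rewrite // mulr0 addr0.
have [IM|IT] := maxM _ rI MI.
  by apply: nMx; rewrite -IM; exists 0 => //; exists 1; rewrite // mulr1 add0r.
have [m Mm [r _ E]] : I 1 by rewrite IT.
have [y yE] := inv r; apply: nMT; apply: right_idealT => //.
by rewrite -yE -E addrK; exact: MM.
Qed.

Lemma Jac_idem e : e * e = e -> Jac R e -> e = 0.
Proof.
move=> ee /Jac_right_inv[y ey]; rewrite -[e]mulr1 -ey mulrA mulrBr mulr1 ee.
by rewrite subrr mul0r.
Qed.

Lemma nilpotent_right_inv x n : x ^+ n = 0 -> exists y, (1 - x) * y = 1.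
Proof.
move=> xn; exists (\sum_(i < n) x ^+ i).
by have := subrX1 x n; rewrite xn sub0r => /(congr1 -%R); rewrite opprK -mulNr opprB.
Qed.

(** The idempotent [x * b] lies in the radical, so it vanishes, and with it the power [x ^+ k]. *)
Lemma Jac_nil : (forall a : R, exists b, drazin a b) ->
  forall x, Jac R x -> exists n, x ^+ n = 0.
Proof.
move=> dR x Jx; have [b xb] := dR x; have [_ _ [k hk]] := xb; exists k.
have /Jac_idem E : x * b * (x * b) = x * b by exact: drazin_idem.
rewrite -hk exprSr -mulrA E ?mulr0//.
by have [_ _ JM] := right_ideal_Jac R; exact: JM.
Qed.

End RightIdeals.

(** * Semiperfect rings *)

Definition rmorphism_of (A B : pzRingType) (f : A -> B)
    (fB : zmod_morphism f) (fM : monoid_morphism f) : {rmorphism A -> B} :=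
  HB.pack_for {rmorphism A -> B} f (GRing.isZmodMorphism.Build A B f fB)
    (GRing.isMonoidMorphism.Build A B f fM).

(* The morphism instances of [\pi_(modJ R)] are shadowed by the generic ones
   for ring quotients; opacity keeps simplification from exposing [\pi]. *)
Lemma piJ_exists (R : pzRingType) :
  {f : {rmorphism R -> modJ R} | f = \pi_(modJ R) :> (R -> modJ R)}.
Proof.
by exists (rmorphism_of (@pi_modJ_is_zmod_morphism R) (@pi_modJ_is_monoid_morphism R)).
Qed.

Definition piJ (R : pzRingType) : {rmorphism R -> modJ R} := sval (piJ_exists R).

Lemma piJE (R : pzRingType) : piJ R = \pi_(modJ R) :> (R -> modJ R).
Proof. exact: svalP (piJ_exists R). Qed.

Section ModJ.
Variable R : pzRingType.
Local Notation piJ := (piJ R).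

Lemma pi_modJ_eq0 (x : R) : piJ x = 0 <-> Jac R x.
Proof.
rewrite -(rmorph0 piJ) -[x in Jac R x]subr0 piJE.
by split=> [/eqP/Defs.eqmodP|/Defs.eqmodP/eqP].
Qed.

Lemma pi_modJ_surj (u : modJ R) : exists x, piJ x = u.
Proof. by exists (repr u); rewrite piJE; exact: reprK. Qed.

Lemma right_ideal_preim (U : set (modJ R)) :
  right_ideal U -> right_ideal (piJ @^-1` U).
Proof.
case=> U0 UB UM; split=> [|x y Ux Uy|x r Ux]; rewrite /= ?rmorph0//.
- by rewrite rmorphB; exact: UB.
- by rewrite rmorphM; exact: UM.
Qed.

(** A chain condition that passes to subrings of finite products, and from which, given Drazin
    inverses, artinianness modulo the radical is recovered. *)
Definition finite_orthogonal := forall e : nat -> R,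
  (forall n, e n * e n = e n) -> (forall m n, (m < n)%N -> e m * e n = 0) ->
  (forall m n, (m < n)%N -> e n * e m = 0) ->
  exists N, forall n, (N <= n)%N -> e n = 0.

(** The right annihilators [U n] of the first [n] idempotents decrease. Once they are stationary,
    [e n] annihilates itself modulo the radical, and an idempotent in the radical is zero. *)
Lemma artinian_finite_orthogonal : right_artinian (modJ R) -> finite_orthogonal.
Proof.
move=> aR e ee e_lt _.
pose U n := [set u : modJ R | forall i, (i < n)%N -> piJ (e i) * u = 0].
have [||N UN] := aR U.
- move=> n; split=> [i _|u v Uu Uv i lin|u r Uu i lin]; first by rewrite mulr0.
    by rewrite mulrBr Uu// Uv// subrr.
  by rewrite mulrA Uu// mul0r.
- by move=> n u Uu i lin; apply: Uu; exact: ltnW.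
exists N => n Nn; apply: Jac_idem => //; apply/pi_modJ_eq0.
have : U n (piJ (e n)) by move=> i lin; rewrite -rmorphM e_lt ?rmorph0.
rewrite UN// -(UN n.+1 (leqW Nn)) => /(_ n (ltnSn n)).
by rewrite -rmorphM ee.
Qed.

Hypothesis dR : forall a : R, exists b, drazin a b.

(** For a lift [x] of [u], the Drazin inverse [b] maps to that of [u], which is [u] itself; so the
    idempotent [x * b] maps to [u * u = u]. *)
Lemma drazin_idempotents_lift : idempotents_lift R.
Proof.
move=> u uu; have [x xu] := pi_modJ_surj u; have [b xb] := dR x.
exists (x * b); first exact: drazin_idem.
have ub : drazin u (piJ b) by rewrite -xu; exact: rmorph_drazin.
have ud : drazin u u by split; rewrite ?uu//; exists 1%N; rewrite !exprS mulr1 !uu.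
by rewrite -piJE rmorphM xu (drazin_uniq ub ud).
Qed.

Hypothesis foR : finite_orthogonal.

(* Otherwise a sequence of nonzero idempotents [G n], each orthogonal to
   [E n = G 0 + ... + G n.-1], could be built. *)
Lemma right_ideal_max_idem I : right_ideal I -> exists e : R,
  [/\ I e, e * e = e & forall g, I g -> g * g = g -> e * g = 0 -> g * e = 0 -> g = 0].
Proof.
move=> rI; have [I0 _ _] := rI; apply: contrapT => nmax.
have /choice[g gP] : forall e : R, exists g, I e -> e * e = e ->
    [/\ I g, g * g = g, e * g = 0, g * e = 0 & g <> 0].
  move=> e; apply: contrapT => ng; apply: nmax; exists e; split.
  - by apply: contrapT => nIe; apply: ng; exists 0 => /nIe.
  - by apply: contrapT => nee; apply: ng; exists 0 => _ /nee.
  - move=> g Ig gg eg ge; apply: contrapT => g0.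
    by apply: ng; exists g.
pose E n := iter n (fun e => e + g e) 0.
have EP n : I (E n) /\ E n * E n = E n.
  elim: n => [|n [IE EE]]; first by rewrite mulr0.
  have [Ig gg eg ge _] := gP _ IE EE; split; first exact: right_idealD.
  by rewrite /= mulrDl !mulrDr EE eg ge gg addr0 add0r.
pose G n := g (E n).
have GP n : [/\ I (G n), G n * G n = G n, E n * G n = 0, G n * E n = 0 & G n <> 0].
  by have [] := EP n; exact: gP.
(* Each [G m] lies below all later sums [E n], while [G n] is orthogonal to [E n]; this makes the
   [G n] pairwise orthogonal. *)
have EG m n : (m < n)%N -> E n * G m = G m /\ G m * E n = G m.
  elim: n => // n IHn; rewrite ltnS leq_eqVlt => /predU1P[->|/IHn[EGn GEn]].
    by have [_ gg eg ge _] := GP n; rewrite /= mulrDl mulrDr eg ge gg add0r.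
  have [_ _ eg ge _] := GP n; rewrite /= mulrDl mulrDr -/(G n).
  have -> : G n * G m = 0 by rewrite -EGn mulrA ge mul0r.
  have -> : G m * G n = 0 by rewrite -GEn -mulrA eg mulr0.
  by rewrite !addr0.
have [|||N GN] := @foR G.
- by move=> n; have [] := GP n.
- move=> m n /EG[_ <-]; have [_ _ eg _ _] := GP n.
  by rewrite -mulrA eg mulr0.
- move=> m n /EG[<- _]; have [_ _ _ ge _] := GP n.
  by rewrite mulrA ge mul0r.
by have [_ _ _ _ []] := GP N; exact: GN.
Qed.

(** A maximal idempotent [e] of [I] works. For [w = (x - e * x) * r], the idempotent [g = w * b]
    lies in [I] and satisfies [e * g = 0]; maximality forces [g = 0], so [w] is nilpotent and
    [1 - w] is right invertible. *)
Lemma right_ideal_idem_mod_Jac I : right_ideal I ->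
  exists e : R, [/\ I e, e * e = e & forall x, I x -> Jac R (x - e * x)].
Proof.
move=> rI; have [I0 IB IM] := rI; have [e [Ie ee emax]] := right_ideal_max_idem rI.
exists e; split=> // x Ix; apply/JacP => r; set w := (x - e * x) * r.
have Iw : I w by apply/IM/IB/IM.
have ew : e * w = 0 by rewrite /w mulrA mulrBr mulrA ee subrr mul0r.
have [b wb] := dR w; have [_ _ [k hk]] := wb.
have gg := drazin_idem wb.
have [g gw] : exists g, g = w * b by eexists.
rewrite -gw in gg.
have eg : e * g = 0 by rewrite gw mulrA ew mul0r.
have Ig : I g by rewrite gw; exact: IM.
have geg : g * e * g = 0 by rewrite -mulrA eg mulr0.
(* Only [e * g = 0] is known; subtracting [g * e] gives an idempotent orthogonal to [e] on both
   sides. *)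
have gE : g - g * e = 0.
  apply: emax; first exact/IB/IM.
  - by rewrite mulrBr !mulrBl !mulrA gg geg mul0r !subr0.
  - by rewrite mulrBr mulrA eg mul0r subrr.
  - by rewrite mulrBl -mulrA ee subrr.
have g0 : g = 0 by rewrite -gg -[g in g * _]subr0 -gE opprB addrC subrK geg.
by apply: (@nilpotent_right_inv _ _ k); rewrite -hk exprSr -mulrA -gw g0 mulr0.
Qed.

(** Modulo the radical, [U] is generated by the image of an idempotent, whose right annihilator is a
    complement. *)
Lemma drazin_semisimple : semisimple (modJ R).
Proof.
move=> U rU; have [U0 UB UM] := rU.
have [e [Ue ee eU]] := right_ideal_idem_mod_Jac (right_ideal_preim rU).
have uE u : U u -> piJ e * u = u.
  have [x <-] := pi_modJ_surj u => /eU /pi_modJ_eq0 /eqP.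
  by rewrite rmorphB rmorphM subr_eq0 => /eqP <-.
have pee : piJ e * piJ e = piJ e by rewrite -rmorphM ee.
exists [set u | piJ e * u = 0]; split.
- split=> [|u v /= eu ev|u r /= eu]; first by rewrite /= mulr0.
    by rewrite mulrBr eu ev subrr.
  by rewrite mulrA eu mul0r.
- apply/seteqP; split=> [u [/uE {2}<- /= ->//]|_ ->].
  by split=> //=; rewrite mulr0.
- apply/seteqP; split=> // u _; exists (piJ e * u); first exact: UM.
  exists (u - piJ e * u); first by rewrite /= mulrBr mulrA pee subrr.
  by rewrite addrC subrK.
Qed.

(** The terms of the chain are generated, modulo the radical, by idempotents [f n]. Choosing these
    decreasing makes the differences [f n - f n.+1] orthogonal idempotents, so the [f n] are
    eventually constant. *)
Lemma drazin_right_artinian : right_artinian (modJ R).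
Proof.
move=> U rU dU; pose I n := piJ @^-1` U n.
have rI n : right_ideal (I n) by exact: right_ideal_preim.
have dI n : I n.+1 `<=` I n by move=> x /dU.
have IJ n x y : I n x -> Jac R (y - x) -> I n y.
  move=> Ix /pi_modJ_eq0 /eqP; rewrite rmorphB subr_eq0 => /eqP yx.
  by rewrite /I /= yx.
pose P n f := [/\ I n f, f * f = f & forall x, I n x -> Jac R (x - f * x)].
have step n f : P n f -> exists f', [/\ P n.+1 f', f * f' = f' & f' * f = f'].
  case=> _ ff fI; have [_ _ IM] := rI n.+1; have [I0 IB _] := rI n.+1.
  have [|e [[Ie fe] ee eL]] :=
      @right_ideal_idem_mod_Jac [set x | I n.+1 x /\ f * x = x].
    split=> [|x y [Ix fx] [Iy fy]|x r [Ix fx]]; first by split; rewrite ?mulr0.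
      by split; [exact: IB|rewrite mulrBr fx fy].
    by split; [exact: IM|rewrite mulrA fx].
  (* The idempotent [e] satisfies [f * e = e] only; [e * f] lies below [f] on both sides. *)
  exists (e * f); split; last 2 first.
  - by rewrite mulrA fe.
  - by rewrite -mulrA ff.
  split; first exact: IM.
    by rewrite -mulrA (mulrA f) fe mulrA ee.
  move=> x Ix; have Jx := fI _ (dI _ _ Ix).
  have Ifx : I n.+1 (f * x).
    by apply: IJ Ix _; rewrite -opprB; exact: JacN.
  have := JacD Jx (eL (f * x) _); rewrite addrA subrK mulrA; apply.
  by split=> //; rewrite mulrA ff.
have [f0 Pf0] : exists f, P 0%N f.
  by have [f [If ff fI]] := right_ideal_idem_mod_Jac (rI 0%N); exists f.
have /choice[h hP] : forall p : nat * R, exists f', P p.1 p.2 ->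
    [/\ P p.1.+1 f', p.2 * f' = f' & f' * p.2 = f'].
  move=> [n f]; have [Pf|nPf] := pselect (P n f); last by exists 0.
  by have [f' f'P] := step n f Pf; exists f'.
pose fix f n := if n is n'.+1 then h (n', f n') else f0.
have fP n : P n (f n).
  by elim: n => // n Pn; have [] := hP (n, f n) Pn.
have fS n : f n * f n.+1 = f n.+1 /\ f n.+1 * f n = f n.+1.
  by have [_] := hP (n, f n) (fP n).
have ff n : f n * f n = f n by have [] := fP n.
have f_le m n : (m <= n)%N -> f m * f n = f n /\ f n * f m = f n.
  elim: n => [|n IHn]; first by rewrite leqn0 => /eqP ->.
  rewrite leq_eqVlt => /predU1P[->//|]; rewrite ltnS => /IHn[mn nm].
  have [S1 S2] := fS n; rewrite -{1}S1 mulrA mn S1; split=> //.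
  by rewrite -{1}S2 -mulrA nm S2.
have [|||N GN] := @foR (fun n => f n - f n.+1).
- move=> n; have [S1 S2] := fS n.
  by rewrite mulrBl !mulrBr !ff S1 S2 subrr subr0.
- move=> m n mn; rewrite mulrBl !mulrBr.
  have [-> _] := f_le m n (ltnW mn); have [-> _] := f_le m n.+1 (leqW (ltnW mn)).
  have [-> _] := f_le m.+1 n mn.
  by have [-> _] := f_le m.+1 n.+1 (leqW mn); rewrite subrr.
- move=> m n mn; rewrite mulrBl !mulrBr.
  have [_ ->] := f_le m n (ltnW mn); have [_ ->] := f_le m n.+1 (leqW (ltnW mn)).
  have [_ ->] := f_le m.+1 n mn.
  by have [_ ->] := f_le m.+1 n.+1 (leqW mn); rewrite !subrr.
have fN n : (N <= n)%N -> f n = f N.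
  elim: n => [|n IHn]; first by rewrite leqn0 => /eqP ->.
  rewrite leq_eqVlt => /predU1P[->//|]; rewrite ltnS => Nn.
  by rewrite -IHn//; apply/esym/eqP; rewrite -subr_eq0 GN.
exists N => n Nn; apply/seteqP; split=> u.
  by rewrite -(subnK Nn); elim: (n - N)%N => // k IHk /dU.
have [x <-] := pi_modJ_surj u => Ux.
have [_ _ /(_ x Ux) Jx] := fP N; have [In _ _] := fP n; have [_ _ IM] := rI n.
by apply: IJ Jx; rewrite -(fN n Nn); exact: IM.
Qed.

Lemma drazin_semiperfect : semiperfect R.
Proof.
by split; [split; [exact: drazin_semisimple|exact: drazin_right_artinian]
          |exact: drazin_idempotents_lift].
Qed.

End ModJ.

(** * Nil sets in semisimple rings *)

(** Products only, without their sums: this suffices for nilpotence and applies to sets that are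
    merely closed under multiplication, such as images of ideals under maps that are not onto. *)
Fixpoint npow (R : pzRingType) (N : set R) (t : nat) : set R :=
  if t is t'.+1 then [set y * z | y in N & z in npow N t'] else [set 1].

Section PowersOfSets.
Variable R : pzRingType.
Implicit Types (N : set R) (x : nat -> R).

Lemma npow1 N : npow N 1 = N.
Proof.
apply/seteqP; split=> [_ [y Ny [_ -> <-]]|y Ny]; first by rewrite mulr1.
by exists y => //; exists 1; rewrite ?mulr1.
Qed.

Lemma npowD N m n : npow N (m + n) = [set y * z | y in npow N m & z in npow N n].
Proof.
elim: m => [|m IHm].
  apply/seteqP; split=> [z Nz|_ [_ -> [z Nz <-]]]; last by rewrite mul1r.
  by exists 1 => //; exists z => //; rewrite mul1r.
rewrite addSn /= IHm; apply/seteqP; split.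
  move=> _ [y Ny [_ [z Nz [w Nw <-]] <-]].
  exists (y * z); first by exists y => //; exists z.
  by exists w => //; rewrite mulrA.
move=> _ [_ [y Ny [z Nz <-]] [w Nw <-]]; exists y => //.
by exists (z * w); [exists z => //; exists w|rewrite mulrA].
Qed.

Lemma npowM N m n : npow N (n * m) = npow (npow N m) n.
Proof. by elim: n => // n IHn; rewrite mulSn npowD IHn. Qed.

Lemma sub_npow N M t : N `<=` M -> npow N t `<=` npow M t.
Proof.
move=> NM; elim: t => //= t IHt _ [y Ny [z Nz <-]].
by exists y; [exact: NM|exists z => //; exact: IHt].
Qed.

Lemma npow_lprod N x t : (forall n, N (x n)) -> npow N t (lprod x t).
Proof. by move=> Nx; elim: t => //= t IHt; exists (x t) => //; exists (lprod x t). Qed.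

Lemma npow_prod N t (x : 'I_t -> R) : (forall i, N (x i)) -> npow N t (\prod_(i < t) x i).
Proof.
elim: t x => [|t IHt] x Nx; first by rewrite big_ord0.
rewrite big_ord_recl; exists (x ord0) => //.
by exists (\prod_(i < t) x (lift ord0 i)) => //; apply: IHt.
Qed.

Lemma npow_prodP N t z : N 0 -> npow N t z ->
  exists2 x : nat -> R, (forall n, N (x n)) & z = \prod_(i < t) x i.
Proof.
move=> N0; elim: t z => [|t IHt] z.
  by move=> ->; exists (fun=> 0) => //; rewrite big_ord0.
case=> y Ny [w /IHt[x Nx ->] <-].
exists (fun n => if n is n'.+1 then x n' else y); first by case.
by rewrite big_ord_recl.
Qed.

Lemma nilpotentP N : N 0 -> nilpotent N <-> exists t, npow N t `<=` [set 0].
Proof.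
move=> N0; split=> [[t Nt]|[t Nt]]; exists t.
  by move=> z /(npow_prodP N0)[x Nx ->]; exact: Nt.
by move=> x Nx; apply: Nt; exact: npow_prod.
Qed.

Lemma lprodD x m n : lprod x (m + n) = lprod (fun i => x (i + n)%N) m * lprod x n.
Proof. by elim: m => [|m IHm] /=; rewrite ?mul1r// IHm mulrA. Qed.

Lemma lprod_eq0 x m n : (m <= n)%N -> lprod x m = 0 -> lprod x n = 0.
Proof. by move=> /subnK <- E; rewrite lprodD E mulr0. Qed.

(** Cuts a long product into [n] consecutive blocks of length [m], to be treated as single
    factors. *)
Lemma lprodM x m n :
  lprod x (n * m) = lprod (fun i => lprod (fun j => x (j + i * m)%N) m) n.
Proof. by elim: n => // n IHn; rewrite mulSn lprodD IHn. Qed.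

End PowersOfSets.

Lemma npow_rmorph (R S : pzRingType) (f : {rmorphism R -> S}) (N : set R) t z :
  npow N t z -> npow (f @` N) t (f z).
Proof.
elim: t z => [|t IHt] z; first by move=> ->; rewrite rmorph1.
move=> [y Ny [w Nw <-]]; exists (f y); first by exists y.
by exists (f w); [exact: IHt|rewrite rmorphM].
Qed.

Lemma rmorph_lprod (R S : pzRingType) (f : {rmorphism R -> S}) (x : nat -> R) t :
  f (lprod x t) = lprod (f \o x) t.
Proof. by elim: t => [|t IHt] /=; rewrite ?rmorph1// rmorphM IHt. Qed.

Section Levitzki.
Variable A : pzRingType.
Implicit Types (K L X : set A).

Lemma right_artinian_min (Phi : set (set A)) X0 : right_artinian A ->
  Phi `<=` @right_ideal A -> Phi X0 ->
  exists2 X, Phi X & forall Y, Phi Y -> Y `<=` X -> Y = X.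
Proof.
move=> aA rPhi PX0; apply: contrapT => nmin.
have /choice[h hP] : forall X, exists Y, Phi X -> [/\ Phi Y, Y `<=` X & Y <> X].
  move=> X; apply: contrapT => nY; apply: nmin; exists X.
    by apply: contrapT => nPX; apply: nY; exists X => /nPX.
  by move=> Y PY YX; apply: contrapT => nYX; apply: nY; exists Y.
pose I n := iter n h X0.
have PI n : Phi (I n) by elim: n => // n /hP[].
have [|n|n IE] := aA I; first by move=> n; exact: rPhi.
  by have [] := hP _ (PI n).
by have [_ _] := hP _ (PI n); apply; exact: (IE n.+1 (leqnSn n)).
Qed.

(** Decompose [1 = e + k] along a complement [K] of [L]: for [l] in [L], the element
    [l - e * l = k * l] lies in both [L] and [K]. *)
Lemma semisimple_principal L : semisimple A -> right_ideal L ->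
  exists2 e, L e & forall l, L l -> e * l = l.
Proof.
move=> sA rL; have [K [rK LK0 LKT]] := sA L rL.
have [L0 LB LM] := rL; have [_ _ KM] := rK.
have [e Le [k Kk ek]] : [set x + y | x in L & y in K] 1 by rewrite LKT.
exists e => // l Ll.
have kl : k * l = l - e * l by rewrite -{2}[l]mul1r -ek mulrDl addrAC subrr add0r.
suff : (L `&` K) (l - e * l) by rewrite LK0 => /eqP; rewrite subr_eq0 => /eqP <-.
by split; [apply: LB => //; exact: LM|rewrite -kl; exact: KM].
Qed.

Variable N : set A.
Hypotheses (NM : forall y z, N y -> N z -> N (y * z))
  (Nnil : forall x, N x -> exists n, x ^+ n = 0).

Definition stable_ideal K := right_ideal K /\ forall y k, N y -> K k -> K (y * k).

(** If [w * x * L] is not inside [K], the minimality hypothesis gives [x L + K = w x L + K].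
    Iterating, [x L] lies in [w ^+ m * x L + K] for all [m], hence in [K] because [w] is nilpotent;
    stability of [K] then gives a contradiction. *)
Lemma stable_kill K L x : stable_ideal K -> stable_ideal L -> K `<=` L -> N x ->
  (forall w, w = x \/ (exists2 y, N y & w = x * y) ->
     (exists2 l, L l & ~ K (w * x * l)) ->
     [set w * x * l + k | l in L & k in K] = [set x * l + k | l in L & k in K]) ->
  forall w, w = x \/ (exists2 y, N y & w = x * y) -> forall l, L l -> K (w * x * l).
Proof.
move=> [rK sK] [rL sL] KL Nx min w wE l Ll; apply: contrapT => nK.
have E := min w wE (ex_intro2 _ _ l Ll nK).
have Nw : N w by case: wE => [->//|[y Ny ->]]; exact: NM.
have [L0 LB LM] := rL; have [K0 KB KM] := rK.
have iter_w m l' : L l' -> exists2 l'', L l'' &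
    exists2 k, K k & x * l' = w ^+ m * x * l'' + k.
  move=> Ll'; elim: m => [|m [l1 Ll1 [k1 Kk1 E1]]].
    by exists l' => //; exists 0; rewrite // addr0 mul1r.
  have : [set x * l + k | l in L & k in K] (x * l1).
    by exists l1 => //; exists 0; rewrite ?addr0.
  rewrite -E => -[l2 Ll2 [k2 Kk2 E2]]; exists l2 => //.
  exists (w ^+ m * k2 + k1).
    apply: right_idealD => //; elim: (m) => [|p IHp]; first by rewrite mul1r.
    by rewrite exprS -mulrA; exact: sK.
  by rewrite E1 -mulrA -E2 mulrDr !mulrA -exprSr addrA.
have [n wn] := Nnil Nw.
have Kx l' : L l' -> K (x * l').
  by move=> /(iter_w n)[l'' _ [k Kk ->]]; rewrite wn !mul0r add0r.
by apply: nK; rewrite -mulrA; apply: sK => //; exact: Kx.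
Qed.

(* Levitzki's theorem. Take [L] minimal among the right ideals stable under [N]
   that no power of [N] kills, [K] maximal among the stable ones strictly inside
   [L], and [x] in [N] with [x L + K] minimal among those not contained in [K].
   Then [x x L] and [x N x L] lie in [K], so the stable right ideal of the [m] in
   [L] with [x m] and [x N m] in [K] contains [K] and [x L], hence is [L]. *)
Lemma nil_nilpotent : semisimple A -> right_artinian A ->
  exists t, npow N t `<=` [set 0].
Proof.
move=> sA aA; pose good L := exists t, forall z l, npow N t z -> L l -> z * l = 0.
suff [t tP] : good setT by exists t => z Nz; rewrite /= -[z]mulr1; exact: tP.
apply: contrapT => bad.
have [||L [sL badL] minL] :=
  @right_artinian_min [set L | stable_ideal L /\ ~ good L] setT aA.
- by move=> L [[]].
- by split.
have [rL NL] := sL; have [L0 LB LM] := rL.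
have [e Le eL] := semisimple_principal sA rL.
have [||K [[sK KL nKL] _ maxK]] :=
  @Zorn_above _ [set K | [/\ stable_ideal K, K `<=` L & K <> L]] [set 0].
- split.
  + split; last by move=> y _ _ ->; rewrite /= mulr0.
    by split=> [//|_ _ -> ->|_ r ->]; rewrite /= ?subrr ?mul0r.
  + by move=> _ ->.
  + by move=> L_0; apply: badL; exists 0%N => z l _; rewrite -L_0 => ->; rewrite mulr0.
- move=> F F0 FP Fch; split.
  + split; first by apply: right_ideal_bigcup => // X /FP[[]].
    move=> y k Ny [X FX Xk]; exists X => //.
    by have [[_ sX] _ _] := FP _ FX; exact: sX.
  + by move=> k [X /FP[_ XL _]] /XL.
  (* By semisimplicity [L] is generated by [e], so a member of the chain containing [e] would be all
     of [L]; unions of chains thus stay proper. *)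
  + move=> FL; have : L e by [].
    rewrite -FL => -[X FX Xe]; have [[[_ _ XM] _] XL nXL] := FP _ FX.
    apply: nXL; apply/seteqP; split=> // l Ll; rewrite -(eL l Ll); exact: XM.
have [rK NK] := sK; have [K0 KB KM] := rK.
have [t tK] : good K.
  by apply: contrapT => badK; apply: nKL; apply: minL.
(* Otherwise [N] maps [L] into [K], and one factor more than the [t] killing [K] would kill [L]. *)
have [x0 Nx0 [l0 Ll0 nK0]] : exists2 x, N x & exists2 l, L l & ~ K (x * l).
  apply: contrapT => nx; apply: badL; exists t.+1 => z l; rewrite -addn1 npowD npow1.
  move=> [w Nw [x Nx <-]] Ll; rewrite -mulrA; apply: tK => //.
  by apply: contrapT => nKx; apply: nx; exists x => //; exists l.
pose XI x := [set x * l + k | l in L & k in K].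
have rXI x : right_ideal (XI x).
  split=> [|_ _ [l Ll [k Kk <-]] [l' Ll' [k' Kk' <-]]|_ r [l Ll [k Kk <-]]].
  - by exists 0 => //; exists 0; rewrite // mulr0 addr0.
  - exists (l - l'); first exact: LB.
    by exists (k - k'); [exact: KB|rewrite mulrBr opprD addrACA].
  - exists (l * r); first exact: LM.
    by exists (k * r); [exact: KM|rewrite mulrDl mulrA].
have [||_ [x [Nx [l1 Ll1 nK1]] <-] minx] := @right_artinian_min
    [set XI x | x in [set x | N x /\ exists2 l, L l & ~ K (x * l)]] (XI x0) aA.
- by move=> _ [x _ <-].
- by exists x0 => //; split=> //; exists l0.
have kill := @stable_kill K L x sK sL KL Nx.
have {}kill w : w = x \/ (exists2 y, N y & w = x * y) -> forall l, L l -> K (w * x * l).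
  apply: kill => {}w wE exl; apply: minx.
    exists (w * x) => //; split=> //; apply: NM => //.
    by case: wE => [->//|[y Ny ->]]; exact: NM.
  move=> _ [l Ll [k Kk <-]]; case: wE => [->|[y Ny ->]].
    by exists (x * l); [exact: NL|exists k; rewrite // mulrA].
  by exists (y * x * l); [rewrite -mulrA; apply/NL/NL|exists k; rewrite // !mulrA].
pose M := [set m | [/\ L m, K (x * m) & forall y, N y -> K (x * y * m)]].
have ML : M = K.
  apply: maxK.
    split=> [|m []//|LM'].
      split; first split=> [|m m' [Lm Km Nm] [Lm' Km' Nm']|m r [Lm Km Nm]].
      - by split=> [//||y Ny]; rewrite mulr0.
      - split; first exact: LB.
          by rewrite mulrBr; exact: KB.
        by move=> y Ny; rewrite mulrBr; apply: KB; [exact: Nm|exact: Nm'].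
      - split; first exact: LM.
          by rewrite mulrA; exact: KM.
        by move=> y Ny; rewrite mulrA; apply: KM; exact: Nm.
      move=> y m Ny [Lm Km Nm]; split; first exact: NL.
        by rewrite mulrA; exact: Nm.
      by move=> y' Ny'; rewrite mulrA -(mulrA x); apply: Nm; exact: NM.
    have : M l1 by rewrite LM'.
    by case=> _ /nK1.
  move=> k Kk; split; [exact: KL|exact: NK|].
  by move=> y Ny; apply: NK => //; exact: NM.
have : M (x * l1).
  split; first exact: NL.
    by rewrite mulrA; apply: kill => //; left.
  by move=> y Ny; rewrite mulrA; apply: kill => //; right; exists y.
by rewrite ML.
Qed.

End Levitzki.

(** * Transfer along embeddings in finite products *)

Lemma converseX (R : pzRingType) (a : R) n : (a : R^c) ^+ n = a ^+ n.
Proof. by elim: n => // n IHn; rewrite exprS IHn [RHS]exprSr. Qed.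

(** The Drazin equations are self-dual, so the right-handed statement is used in the opposite
    ring. *)
Lemma left_pi_regular_drazin (R : pzRingType) :
  (forall a : R, exists n y, a ^+ n = y * a ^+ n.+1) ->
  forall a : R, exists b, drazin a b.
Proof.
move=> lR a; have [|b [ab bab [k hk]]] := @right_pi_regular_drazin R^c _ a.
  by move=> x; have [n [y xy]] := lR x; exists n, y; rewrite !converseX.
have ba : GRing.comm (b : R) a by exact: ab.
have bk : @GRing.mul R b (a ^+ k.+1) = a ^+ k by move: hk; rewrite !converseX.
exists b; split; first exact: esym.
  by rewrite -mulrA; exact: bab.
by exists k; rewrite -(commrX k.+1 ba).
Qed.

(** * Drazin inverses in right perfect rings *)

Section RightPerfect.
Variable R : pzRingType.

Lemma semiprimary_right_perfect : semiprimary R -> right_perfect R.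
Proof.
have [J0 _ _] := right_ideal_Jac R.
case=> slR /(nilpotentP J0)[t tJ]; split=> // x Jx; exists t => n tn.
by apply: (lprod_eq0 (leqW tn)); apply: tJ; exact: npow_lprod.
Qed.

(* Modulo [Jac R] some power [a] of [a0] satisfies [a = b * a ^+ 2], so
   [a = j + b * a ^+ 2] with [j] in [Jac R]. Solving this recurrence gives
   [a ^+ n = lprod x n + q n * a ^+ n.+1] with all [x n] in [Jac R]: the new
   factors appear on the left, as right T-nilpotence requires. *)
Lemma right_perfect_drazin : right_perfect R -> forall a : R, exists b, drazin a b.
Proof.
case=> [[_ aR] tnil]; apply: left_pi_regular_drazin => a0.
have [|b0 [ab bab [k hk]]] := @right_pi_regular_drazin (modJ R) _ (piJ R a0).
  move=> u; have [n|n m|n UE] := aR (fun n => range (fun r => u ^+ n * r)).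
  - exact: right_ideal_principal.
  - by move=> [r _ <-]; exists (u * r) => //=; rewrite mulrA -exprSr.
  have : range (fun r => u ^+ n * r) (u ^+ n) by exists 1; rewrite ?mulr1.
  by rewrite -(UE n.+1 (leqnSn n)) => -[y _ uy]; exists n, y; rewrite uy.
have [b bE] := pi_modJ_surj (b0 ^+ k.+1).
pose a := a0 ^+ k.+1; pose j := a - b * (a * a).
have Jj : Jac R j.
  apply/pi_modJ_eq0; rewrite rmorphB !rmorphM bE /a rmorphXn -exprD.
  have -> : b0 ^+ k.+1 * piJ R a0 ^+ (k.+1 + k.+1) = piJ R a0 ^+ k.+1.
    set u := piJ R a0 in ab hk *; elim: {1 3}k.+1 => [|n IHn].
      by rewrite mul1r addn0.
    rewrite addnS exprSr -mulrA (commrX _ (esym ab) : b0 * _ = _).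
    by rewrite (drazin_index hk) ?IHn// leqW// leq_addr.
  by rewrite subrr.
have aE : a = j + b * (a * a) by rewrite subrK.
have /choice[h hP] : forall q, exists v, v * (1 - j * q) = 1.
  move=> q; have [_ _ JM] := right_ideal_Jac R.
  by have [v [_ v1]] := Jac_unit (JM _ q Jj); exists v.
(* Multiplying [(1 - j * q n) * a ^+ n.+1 = j * lprod x n + b * a ^+ n.+2] by [h (q n)] on the left
   dictates the next factor [x n] and the next coefficient [q n.+1]. *)
pose fix q n := if n is n'.+1 then h (q n') * b else 0.
pose x n := h (q n) * j.
have Jx n : Jac R (x n) by exact: Jac_mulr.
have aX n : a ^+ n = lprod x n + q n * a ^+ n.+1.
  elim: n => [|n IHn]; first by rewrite /= mul0r addr0.
  have E : (1 - j * q n) * a ^+ n.+1 = j * lprod x n + b * a ^+ n.+2.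
    rewrite mulrBl mul1r {1}exprS {1}aE mulrDl -!mulrA -!exprS {1}IHn.
    by rewrite mulrDr mulrA addrAC addrK.
  by rewrite -[a ^+ n.+1]mul1r -(hP (q n)) -mulrA E mulrDr !mulrA.
have [M xM] := tnil x Jx.
have := aX M.+1; rewrite (xM M (leqnn M)) add0r /a -!exprM => E.
(* Passing from [a ^+ M.+1] to the next power adds [k.+1] factors [a0]; all but one go into the
   coefficient. *)
exists (k.+1 * M.+1)%N, (q M.+1 * a0 ^+ k).
by rewrite {1}E mulnS -mulrA -exprD -addSnnS.
Qed.

End RightPerfect.

Definition admissible_property (P : pzRingType -> Prop) :=
  P = semiprimary \/ P = right_perfect \/ P = pi_regular_semiperfect \/ P = pi_regular.

Lemma admissible_property_drazin (P : pzRingType -> Prop) (R : pzRingType) :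
  admissible_property P -> P R -> forall a : R, exists b, drazin a b.
Proof.
move=> [|[|[|]]] -> => [/semiprimary_right_perfect|||]; try exact: right_perfect_drazin.
  by case=> /pi_regular_drazin.
exact: pi_regular_drazin.
Qed.

Section Embedding.
Variables (R : pzRingType) (n : nat) (D : 'I_n -> pzRingType).
Variable f : forall i, {rmorphism R -> D i}.
Hypothesis f_inj : forall x : R, (forall i, f i x = 0) -> x = 0.
Hypothesis dR : forall a : R, exists b, drazin a b.

(** Finiteness of the product enters through this bound, which merges one exponent per factor into a
    common one. *)
Lemma ord_uniform_bound (Q : 'I_n -> nat -> Prop) :
  (forall i m m', (m <= m')%N -> Q i m -> Q i m') ->
  (forall i, exists m, Q i m) -> exists m, forall i, Q i m.
Proof.
move=> mono /choice[b bQ]; exists (\max_i b i) => i.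
by apply: mono (bQ i); exact: leq_bigmax.
Qed.

Lemma embedding_finite_orthogonal :
  (forall i, finite_orthogonal (D i)) -> finite_orthogonal R.
Proof.
move=> foD e ee e_lt e_gt.
have [i m m' mm' em m'' /(leq_trans mm')/em//|i|N eN] := @ord_uniform_bound
    (fun i N => forall m, (N <= m)%N -> f i (e m) = 0).
  apply: (foD i (f i \o e)) => [m|m m' mm'|m m' mm'] /=; rewrite -rmorphM.
  - by rewrite ee.
  - by rewrite e_lt// rmorph0.
  - by rewrite e_gt// rmorph0.
by exists N => m Nm; apply: f_inj => i; exact: eN.
Qed.

(** Since [f i] need not be onto, [Jac R] itself may fail to map into [Jac (D i)]. Its image in
    [modJ (D i)] is however nil and closed under products, hence nilpotent by [nil_nilpotent]. *)
Lemma Jac_pow_embedding : (forall i, semilocal (D i)) ->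
  exists T, forall i z, npow (Jac R) T z -> Jac (D i) (f i z).
Proof.
move=> slD; apply: ord_uniform_bound => [i m m' /subnK <- mP z|i].
  by rewrite npowD => -[y _ [w /mP Jw <-]]; rewrite rmorphM; exact: Jac_mulr.
pose g x := piJ (D i) (f i x).
have [sD aD] := slD i.
have [|_ [y Jy <-]|t tP] := @nil_nilpotent (modJ (D i)) (g @` Jac R) _ _ sD aD.
- move=> _ _ [y Jy <-] [z Jz <-]; exists (y * z); first exact: Jac_mulr.
  by rewrite /g !rmorphM.
- have [m ym] := Jac_nil dR Jy; exists m.
  by rewrite /g -!rmorphXn ym !rmorph0.
exists t => z Jz; apply/pi_modJ_eq0; apply: tP.
exact: (@npow_rmorph _ _ (piJ (D i) \o f i)).
Qed.

(** Pi-regularity and semiperfectness come from the Drazin inverses of [R]; nilpotence or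
    T-nilpotence of [Jac R] is pulled back from the factors after grouping products into blocks of
    length [T]. *)
Lemma embedding_property (P : pzRingType -> Prop) :
  admissible_property P -> (forall i, P (D i)) -> P R.
Proof.
have JR0 : Jac R 0 by have [] := right_ideal_Jac R.
have slR : (forall i, semilocal (D i)) -> semiperfect R.
  move=> slD; apply: drazin_semiperfect => //.
  apply: embedding_finite_orthogonal => i.
  by apply: artinian_finite_orthogonal; have [] := slD i.
case=> [|[|[|]]] -> PD.
- have slD i : semilocal (D i) by have [] := PD i.
  have [T TP] := Jac_pow_embedding slD.
  split; first by have [] := slR slD.
  have [||S SP] := @ord_uniform_bound (fun i s => npow (Jac (D i)) s `<=` [set 0]).
  + move=> i m m' /subnK <- mP z; rewrite npowD => -[y _ [w /mP -> <-]].
    by rewrite /= mulr0.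
  + move=> i; have [JD0 _ _] := right_ideal_Jac (D i).
    by apply/(nilpotentP JD0); have [] := PD i.
  apply/(nilpotentP JR0); exists (S * T)%N => z; rewrite npowM => Jz.
  apply: f_inj => i; apply: SP; apply: sub_npow (npow_rmorph (f i) Jz).
  by move=> _ [y /TP Jy <-]; exact: Jy.
- have slD i : semilocal (D i) by have [] := PD i.
  have [T TP] := Jac_pow_embedding slD.
  split; first by have [] := slR slD.
  move=> x Jx; have [||M MP] := @ord_uniform_bound (fun i m => f i (lprod x m) = 0).
  + by move=> i m m' mm'; rewrite !rmorph_lprod; exact: lprod_eq0.
  (* The blocks [y k] lie in [Jac (D i)], so T-nilpotence there applies to them; [N.+1] blocks are
     taken because the bound concerns [lprod y n.+1]. *)
  + move=> i; pose y k := f i (lprod (fun l => x (l + k * T)%N) T).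
    have [k|N NP] := (PD i).2 y; first by apply: TP; exact: npow_lprod.
    exists (N.+1 * T)%N; rewrite lprodM rmorph_lprod; exact: NP (leqnn N).
  by exists M => m Mm; apply: (lprod_eq0 (leqW Mm)); exact: f_inj.
- by split; [exact: drazin_pi_regular|apply: slR => i; have [_ []] := PD i].
- exact: drazin_pi_regular.
Qed.

End Embedding.

(** * Strictly pro-P rings *)

Section Discrete.
Implicit Types X Y : topologicalType.

Lemma discrete_nbhs X (x : X) (A : set X) : discrete X -> A x -> nbhs x A.
Proof. by move=> dX Ax; apply: open_nbhs_nbhs; split=> //; exact: dX. Qed.

Lemma discrete_continuous X Y (f : X -> Y) : discrete X -> continuous f.
Proof.
by move=> dX x A /nbhs_singleton Afx; exact: (@discrete_nbhs _ x (f @^-1` A)).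
Qed.

Lemma locally_constant_continuous X Y (f : X -> Y) :
  (forall x, \forall y \near x, f y = f x) -> continuous f.
Proof.
move=> cf x A /nbhs_singleton Afx; apply: filterS (cf x) => y.
by rewrite /= => ->.
Qed.

End Discrete.

(** * Images of ring morphisms as discrete rings *)

Section ImageRing.
Variables (R S : pzRingType) (f : {rmorphism R -> S}).

(* Carries the discrete topology, whatever the topology of [S]. *)
Definition image_ring : Type := set_type (range f).

HB.instance Definition _ := SubChoice.on image_ring.

Lemma image_subring : subring_closed (mem (range f)).
Proof.
split=> [|_ _ /set_mem[r _ <-] /set_mem[s _ <-]|_ _ /set_mem[r _ <-] /set_mem[s _ <-]];
  apply/mem_set.
- by exists 1; rewrite ?rmorph1.
- by exists (r - s); rewrite ?rmorphB.
- by exists (r * s); rewrite ?rmorphM.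
Qed.

HB.instance Definition _ := GRing.SubChoice_isSubPzRing.Build
  S (mem (range f)) image_ring image_subring.

HB.instance Definition _ := isOpenTopological.Build image_ring
  (I : (fun=> True) [set: image_ring]) (fun _ _ _ _ => I) (fun _ _ _ => I).

Lemma image_ring_discrete : discrete image_ring.
Proof. by []. Qed.

Lemma image_add_continuous : continuous (fun x : image_ring * image_ring => x.1 + x.2).
Proof.
apply: locally_constant_continuous => x.
exists ([set x.1], [set x.2]); first by split; apply: discrete_nbhs.
by move=> y [/= -> ->].
Qed.

Lemma image_mul_continuous : continuous (fun x : image_ring * image_ring => x.1 * x.2).
Proof.
apply: locally_constant_continuous => x.
exists ([set x.1], [set x.2]); first by split; apply: discrete_nbhs.
by move=> y [/= -> ->].
Qed.

HB.instance Definition _ :=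
  PreTopologicalNmodule_isTopologicalNmodule.Build image_ring image_add_continuous.
HB.instance Definition _ :=
  TopologicalNmodule_isTopologicalZmodule.Build image_ring
    (@discrete_continuous image_ring image_ring -%R image_ring_discrete).
HB.instance Definition _ :=
  TopologicalZmodule_isTopologicalPzRing.Build image_ring image_mul_continuous.

Definition to_image (r : R) : image_ring := exist _ (f r) (mem_set (imageT f r)).

Lemma to_image_zmod_morphism : zmod_morphism to_image.
Proof. by move=> x y; apply: val_inj; rewrite /= rmorphB. Qed.

Lemma to_image_monoid_morphism : monoid_morphism to_image.
Proof. by split=> [|x y]; apply: val_inj; rewrite /= ?rmorph1 ?rmorphM. Qed.

HB.instance Definition _ := GRing.isZmodMorphism.Build R image_ring to_image
  to_image_zmod_morphism.
HB.instance Definition _ := GRing.isMonoidMorphism.Build R image_ring to_image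
  to_image_monoid_morphism.

Lemma to_image_surj (x : image_ring) : exists r, to_image r = x.
Proof. by case: x => x /[dup] /set_mem[r _ rx] xP; exists r; apply: val_inj. Qed.

Lemma to_image_eq r s : to_image r = to_image s <-> f r = f s.
Proof. by split=> [/(congr1 val)|rs]; [|apply: val_inj]. Qed.

End ImageRing.

Section ProductMap.
Variables (R : pzRingType) (I : Type) (D : I -> topologicalPzRingType).
Variable p : forall i, {rmorphism R -> D i}.

Definition tuple_map (r : R) : prod_topology D := fun i => p i r.

Lemma tuple_map_zmod_morphism : zmod_morphism tuple_map.
Proof. by move=> x y; apply: functional_extensionality_dep => i; exact: rmorphB. Qed.

Lemma tuple_map_monoid_morphism : monoid_morphism tuple_map.
Proof.
split=> [|x y]; apply: functional_extensionality_dep => i; first exact: rmorph1.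
exact: rmorphM.
Qed.

HB.instance Definition _ := GRing.isZmodMorphism.Build R (prod_topology D) tuple_map
  tuple_map_zmod_morphism.
HB.instance Definition _ := GRing.isMonoidMorphism.Build R (prod_topology D) tuple_map
  tuple_map_monoid_morphism.

Definition proj_image (i : I) (x : image_ring tuple_map) : D i := \val x i.

Lemma proj_image_zmod_morphism i : zmod_morphism (@proj_image i).
Proof. by []. Qed.

Lemma proj_image_monoid_morphism i : monoid_morphism (@proj_image i).
Proof. by []. Qed.

HB.instance Definition _ i := GRing.isZmodMorphism.Build (image_ring tuple_map) (D i)
  (@proj_image i) (@proj_image_zmod_morphism i).
HB.instance Definition _ i := GRing.isMonoidMorphism.Build (image_ring tuple_map) (D i)
  (@proj_image i) (@proj_image_monoid_morphism i).

Lemma proj_image_inj (x : image_ring tuple_map) : (forall i, proj_image i x = 0) -> x = 0.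
Proof.
by move=> x0; apply: val_inj; apply: functional_extensionality_dep => i; exact: x0.
Qed.

End ProductMap.

Section LimProj.
Variable C : small_category.

Lemma lim_proj_zmod_morphism i : zmod_morphism (@lim_proj C i).
Proof. by []. Qed.

Lemma lim_proj_monoid_morphism i : monoid_morphism (@lim_proj C i).
Proof. by []. Qed.

HB.instance Definition _ i := GRing.isZmodMorphism.Build (inv_lim C) (C i)
  (@lim_proj C i) (@lim_proj_zmod_morphism i).
HB.instance Definition _ i := GRing.isMonoidMorphism.Build (inv_lim C) (C i)
  (@lim_proj C i) (@lim_proj_monoid_morphism i).

Lemma lim_ext (x y : inv_lim C) : (forall i, lim_proj i x = lim_proj i y) -> x = y.
Proof. by move=> xy; apply: val_inj; apply: functional_extensionality_dep. Qed.

Lemma lim_compat (x : inv_lim C) j i (f : C j -> C i) :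
  Defs.hom C j i f -> f (lim_proj j x) = lim_proj i x.
Proof. by move=> hf; have /set_mem := valP x; apply. Qed.

Lemma lim_lift (y : forall i, C i) :
  (forall j i (f : C j -> C i), Defs.hom C j i f -> f (y j) = y i) ->
  exists x : inv_lim C, forall i, lim_proj i x = y i.
Proof. by move=> yC; exists (exist _ (y : prod_topology (@ob C)) (mem_set yC)). Qed.

End LimProj.

(** * The strict inverse system of images in finite subproducts *)

Section StrictlyPro.
Variables (R : topologicalPzRingType) (L : Type) (D : L -> topologicalPzRingType).
Variable p : forall a, {rmorphism R -> D a}.
Hypothesis discreteD : forall a, discrete (D a).
Hypothesis p_continuous : forall a, continuous (p a).
Hypothesis p_inj : forall x : R, (forall a, p a x = 0) -> x = 0.
Hypothesis p_initial : forall (X : topologicalType) (g : X -> R),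
  (forall a, continuous (p a \o g)) -> continuous g.
Hypothesis p_complete : forall y : (forall a, D a),
  (forall n (F : 'I_n -> L), exists r, forall i, p (F i) r = y (F i)) ->
  exists r, forall a, p a r = y a.

Definition finite_family := {n : nat & 'I_n -> L}.
Implicit Types F G : finite_family.

Definition family_map F : {rmorphism R -> prod_topology (fun i => D (tagged F i))} :=
  tuple_map (fun i => p (tagged F i)).
Definition fimage F : topologicalPzRingType := image_ring (family_map F).
Definition to_fimage F : {rmorphism R -> fimage F} := to_image (family_map F).

(** Families are compared by the kernels of their maps rather than by inclusion; this is exactly
    what a transition map between the images requires. *)
Definition fle F G := forall r, to_fimage G r = 0 -> to_fimage F r = 0.

Lemma fimage_eq0 F r : to_fimage F r = 0 <-> forall i, p (tagged F i) r = 0.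
Proof.
rewrite -(rmorph0 (to_fimage F)); split=> [/to_image_eq E i|E].
  by have := congr1 (fun f => f i) E; rewrite /= /tuple_map rmorph0.
by apply/to_image_eq/functional_extensionality_dep => i; rewrite /= /tuple_map E rmorph0.
Qed.

Lemma fle_directed F G : exists2 H, fle F H & fle G H.
Proof.
pose h (k : 'I_(tag F + tag G)) :=
  match fintype.split k with inl i => tagged F i | inr j => tagged G j end.
exists (existT _ _ h) => r /fimage_eq0 Hr; apply/fimage_eq0 => i.
  by have := Hr (lshift _ i); rewrite /= /h; rewrite (unsplitK (inl i)).
by have := Hr (rshift _ i); rewrite /= /h; rewrite (unsplitK (inr i)).
Qed.

Definition family_set : directed_set.
Proof.
apply: (@DirectedSet finite_family fle).
- by move=> F r.
- by move=> F G H FG GH r /GH/FG.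
- by exists (existT _ 0%N (fun i : 'I_0 => False_rect L (notF (ltn_ord i)))).
- exact: fle_directed.
Defined.

Definition flift F (x : fimage F) : R := sval (cid (to_image_surj x)).

Lemma fliftK F : cancel (@flift F) (to_fimage F).
Proof. by move=> x; rewrite /flift; case: cid. Qed.

(** Computed on a chosen lift to [R]; by [ftrmapE] the choice does not matter. *)
Definition ftrmap F G (h : fle F G) (x : fimage G) : fimage F := to_fimage F (flift x).

Lemma ftrmapE F G (h : fle F G) r : ftrmap h (to_fimage G r) = to_fimage F r.
Proof.
apply/eqP; rewrite -subr_eq0 -rmorphB; apply/eqP/h.
by rewrite rmorphB fliftK subrr.
Qed.

Definition family_system : inverse_system.
Proof.
apply: (@InverseSystem family_set fimage (fun F G => @ftrmap F G)).
- by move=> F h x; exact: fliftK.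
- by move=> F G H FG GH FH x; rewrite -[x]fliftK !ftrmapE.
- move=> F G h x y; rewrite -[x]fliftK -[y]fliftK -rmorphB !ftrmapE; exact: rmorphB.
- move=> F G h; split=> [|x y].
    by rewrite -(rmorph1 (to_fimage G)) ftrmapE rmorph1.
  rewrite -[x]fliftK -[y]fliftK -rmorphM !ftrmapE; exact: rmorphM.
- by move=> F G h; exact: discrete_continuous.
Defined.

Local Notation lim := (inv_lim (sys_cat family_system)).

Lemma family_compatible r :
  compatible ((fun F => to_fimage F r) : prod_topology (@ob (sys_cat family_system))).
Proof. by move=> G F _ [h ->]; exact: ftrmapE. Qed.

Definition to_lim r : lim :=
  exist _ ((fun F => to_fimage F r) : prod_topology (@ob (sys_cat family_system)))
    (mem_set (family_compatible r)).

Lemma lim_proj_to_lim r (F : idx (sys_cat family_system)) :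
  lim_proj F (to_lim r) = to_fimage F r.
Proof. by []. Qed.

Lemma to_lim_zmod_morphism : zmod_morphism to_lim.
Proof.
move=> x y; apply: lim_ext => F.
rewrite rmorphB !lim_proj_to_lim; exact: rmorphB.
Qed.

Lemma to_lim_monoid_morphism : monoid_morphism to_lim.
Proof.
split=> [|x y]; apply: lim_ext => F.
  by rewrite lim_proj_to_lim !rmorph1.
by rewrite rmorphM !lim_proj_to_lim; exact: rmorphM.
Qed.

Definition family_single (a : L) : finite_family := existT _ 1%N (fun=> a).

(** The one-element families prescribe a value in every [D a], and larger families show that any
    finitely many of these values come from one element of [R]; [p_complete] then supplies a global
    preimage. *)
Lemma to_lim_surj (x : lim) : exists r, to_lim r = x.
Proof.
have xE F G (h : fle F G) r :
    lim_proj (G : idx (sys_cat family_system)) x = to_fimage G r ->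
    lim_proj (F : idx (sys_cat family_system)) x = to_fimage F r.
  move=> xr; rewrite -(ftrmapE h) -xr; apply/esym.
  by apply: lim_compat; exists h.
pose xr F := flift (lim_proj (F : idx (sys_cat family_system)) x).
have xrE F : lim_proj (F : idx (sys_cat family_system)) x = to_fimage F (xr F).
  by rewrite fliftK.
have xr_single F i :
    p (tagged F i) (xr F) = p (tagged F i) (xr (family_single (tagged F i))).
  have h : fle (family_single (tagged F i)) F.
    by move=> s /fimage_eq0 Fs; apply/fimage_eq0 => j; exact: (Fs i).
  have := xE _ _ h _ (xrE _); rewrite xrE => /eqP.
  rewrite -subr_eq0 -rmorphB => /eqP/fimage_eq0/(_ ord0)/eqP.
  by rewrite rmorphB subr_eq0 => /eqP.
have [r rE] : exists r, forall a, p a r = p a (xr (family_single a)).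
  apply: p_complete => n F; exists (xr (existT _ n F)) => i.
  exact: (xr_single (existT _ n F) i).
exists r; apply: lim_ext => F; rewrite lim_proj_to_lim xrE.
apply/eqP; rewrite -subr_eq0 -rmorphB; apply/eqP/fimage_eq0 => i.
by rewrite rmorphB rE xr_single subrr.
Qed.

Lemma to_lim_inj : injective to_lim.
Proof.
move=> r s rs; apply/eqP; rewrite -subr_eq0; apply/eqP/p_inj => a.
have /(congr1 (lim_proj (family_single a : idx (sys_cat family_system)))) := rs.
rewrite !lim_proj_to_lim => /eqP; rewrite -subr_eq0 -rmorphB => /eqP.
by move=> /fimage_eq0/(_ ord0).
Qed.

Lemma to_fimage_continuous F : continuous (to_fimage F).
Proof.
apply: locally_constant_continuous => r.
have : \forall s \near r, forall i, p (tagged F i) s = p (tagged F i) r.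
  apply: filter_forall => i; set z := p (tagged F i) r.
  exact: (p_continuous (@discrete_nbhs _ z [set z] (@discreteD _) erefl)).
apply: filterS => s sr; apply/eqP; rewrite -subr_eq0 -rmorphB.
by apply/eqP/fimage_eq0 => i; rewrite rmorphB sr subrr.
Qed.

Lemma strictly_pro_family (P : pzRingType -> Prop) :
  (forall F, P (fimage F)) -> strictly_pro P R.
Proof.
move=> PF; exists family_system; split=> //.
pose f := rmorphism_of to_lim_zmod_morphism to_lim_monoid_morphism.
exists f; last first.
  by move=> F; apply/seteqP; split=> // x _; have [r <-] := to_image_surj x; exists r.
have /choice[g gK] := to_lim_surj.
exists g; split.
- by move=> r; apply: to_lim_inj; rewrite gK.
- exact: gK.
- by apply: continuous_lim => F; exact: to_fimage_continuous.
(* Continuity of the inverse is tested on the maps [p a], each factoring through the image for the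
   one-element family at [a]. *)
- apply: p_initial => a x.
  have -> : p a \o g = (fun y : fimage (family_single a) => proj_image ord0 y) \o
     lim_proj (family_single a : idx (sys_cat family_system)).
    by apply: functional_extensionality_dep => y; rewrite /= -{2}(gK y).
  apply: continuous_comp; first exact: lim_proj_continuous.
  exact: discrete_continuous.
Qed.

Hypothesis p_drazin : forall x : R, exists y, forall a, drazin (p a x) (p a y).

(** The first two Drazin equations hold already in [R], since they hold in every [D a]. The exponent
    in the third depends on [a], and becomes uniform only over the finite family [F]. *)
Lemma fimage_drazin F (x : fimage F) : exists y, drazin x y.
Proof.
have [y xy] := p_drazin (flift x).
exists (to_fimage F y); rewrite -[x]fliftK; set r := flift x in xy *.
have ext s t : (forall a, p a s = p a t) -> s = t.
  move=> st; apply/eqP; rewrite -subr_eq0; apply/eqP/p_inj => a.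
  by rewrite rmorphB st subrr.
split.
- rewrite -!rmorphM; congr (to_fimage F _); apply: ext => a.
  by rewrite !rmorphM; have [] := xy a.
- rewrite -!rmorphM; congr (to_fimage F _); apply: ext => a.
  by rewrite !rmorphM; have [] := xy a.
have [|i|k kP] := @ord_uniform_bound _
    (fun i k => p (tagged F i) (r ^+ k.+1 * y) = p (tagged F i) (r ^+ k)).
- by move=> i m m' mm'; rewrite !rmorphM !rmorphXn => /drazin_index; exact.
- by have [_ _ [k hk]] := xy (tagged F i); exists k; rewrite rmorphM !rmorphXn.
exists k; rewrite -!rmorphXn -rmorphM; apply/eqP; rewrite -subr_eq0 -rmorphB.
by apply/eqP/fimage_eq0 => i; rewrite rmorphB kP subrr.
Qed.

Lemma strictly_pro_drazin_family (P : pzRingType -> Prop) :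
  admissible_property P -> (forall a, P (D a)) -> strictly_pro P R.
Proof.
move=> hP PD; apply: strictly_pro_family => F.
apply: (@embedding_property (fimage F) (tag F) (fun i => D (tagged F i))
  (fun i => @proj_image _ _ _ _ i)) => //.
- exact: proj_image_inj.
- exact: fimage_drazin.
Qed.

End StrictlyPro.

(** * Neighbourhoods of zero in the limit of an inverse system *)

Section LimitNeighbourhoods.
Variable S : inverse_system.
Local Notation lim := (inv_lim (sys_cat S)).

Lemma lim_proj_le (i j : sys_idx S) (x : lim) : dle i j ->
  lim_proj (j : idx (sys_cat S)) x = 0 -> lim_proj (i : idx (sys_cat S)) x = 0.
Proof.
move=> h x0.
have hom_h : Defs.hom (sys_cat S) j i (trmap h) by exists h.
rewrite -(lim_compat x hom_h) x0.
by have := hom_zmod_morphism hom_h 0 0; rewrite !subrr.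
Qed.

(** By directedness, the sets containing the kernel of some projection form a filter, and its
    convergence to zero in the product is checked one coordinate at a time. *)
Lemma lim_nbhs0 (U : set lim) : (forall i, discrete (S i)) -> nbhs 0 U ->
  exists k : sys_idx S, forall x, lim_proj (k : idx (sys_cat S)) x = 0 -> U x.
Proof.
move=> dS; case=> B [[V oV <-] V0 VU].
pose Phi : set_system (prod_topology (@ob (sys_cat S))) :=
  [set A | exists k : sys_idx S, forall x : lim,
     lim_proj (k : idx (sys_cat S)) x = 0 -> A (\val x)].
have FPhi : Filter Phi.
  split.
  - by have [k _] := dset_inhabited (sys_idx S); exists k.
  - move=> A A' [k kA] [k' kA']; have [l kl k'l] := dset_directed k k'.
    exists l => x x0; split; [apply: kA|apply: kA']; exact: lim_proj_le x0.
  - by move=> A A' AA' [k kA]; exists k => x /kA/AA'.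
have : Phi --> (\val (0 : lim) : prod_topology (@ob (sys_cat S))).
  apply/cvg_sup => i A [_ [[W oW <-] W0 WA]].
  exists i => x x0; apply: WA; rewrite /=.
  have -> : \val x i = 0 by [].
  exact: W0.
move=> /(_ V) []; first by apply: open_nbhs_nbhs.
by move=> k kV; exists k => x /kV/VU.
Qed.

End LimitNeighbourhoods.

(** * The limit of the category inside the product of all discrete components *)

Section LimitOfPro.
Variables (C : small_category) (S : idx C -> inverse_system).
Variable phi : forall i, {rmorphism C i -> inv_lim (sys_cat (S i))}.
Variable psi : forall i, inv_lim (sys_cat (S i)) -> C i.
Hypothesis discreteS : forall i k, discrete (S i k).
Hypothesis phiK : forall i, cancel (phi i) (@psi i).
Hypothesis psiK : forall i, cancel (@psi i) (phi i).
Hypothesis phi_continuous : forall i, continuous (phi i).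
Hypothesis psi_continuous : forall i, continuous (@psi i).

Definition component := {i : idx C & sys_idx (S i)}.

Definition coord i (k : sys_idx (S i)) : {rmorphism C i -> S i k} :=
  (@lim_proj (sys_cat (S i)) k : {rmorphism _ -> _}) \o phi i.

Definition lim_coord (a : component) : {rmorphism inv_lim C -> S (tag a) (tagged a)} :=
  coord (tagged a) \o (@lim_proj C (tag a) : {rmorphism _ -> _}).

Lemma coord_inj i (c d : C i) : (forall k, coord k c = coord k d) -> c = d.
Proof.
by move=> cd; rewrite -[c]phiK -[d]phiK; congr psi; apply: lim_ext => k; exact: cd.
Qed.

Lemma coord_continuous i (k : sys_idx (S i)) : continuous (coord k).
Proof.
move=> c; apply: continuous_comp; first exact: phi_continuous.
exact: (@lim_proj_continuous (sys_cat (S i)) k).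
Qed.

Lemma coord_trmap i (k l : sys_idx (S i)) (h : dle k l) c :
  trmap h (coord l c) = coord k c.
Proof. by apply: (@lim_compat (sys_cat (S i))); exists h. Qed.

Lemma coord_lift i (y : forall k, S i k) :
  (forall k l (h : dle k l), trmap h (y l) = y k) ->
  exists c : C i, forall k, coord k c = y k.
Proof.
move=> yS; have [|x xy] := @lim_lift (sys_cat (S i)) y.
  by move=> l k _ [h ->]; exact: yS.
by exists (psi x) => k; rewrite /= psiK xy.
Qed.

(** The kernel of [h] is a neighbourhood of zero, hence contains the kernel of a single coordinate
    by [lim_nbhs0]. *)
Lemma coord_factor j (E : topologicalPzRingType) (h : {rmorphism C j -> E}) :
  discrete E -> continuous h ->
  exists k, forall c : C j, coord k c = 0 -> h c = 0.
Proof.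
move=> dE ch; have psi0 : psi 0 = 0 :> C j by rewrite -(rmorph0 (phi j)) phiK.
have [|k kP] := @lim_nbhs0 (S j) [set y | h (psi y) = 0] (@discreteS j).
  have ch0 : h (psi 0) = 0 :> E by rewrite psi0 rmorph0.
  have : nbhs (h (psi (0 : inv_lim (sys_cat (S j))))) [set (0 : E)].
    by apply: discrete_nbhs; rewrite //= ch0.
  by move=> /ch/psi_continuous.
by exists k => c c0; rewrite -[c]phiK; exact: kP.
Qed.

Lemma lim_coord_inj (x : inv_lim C) : (forall a, lim_coord a x = 0) -> x = 0.
Proof.
move=> x0; apply: lim_ext => i; rewrite rmorph0; apply: coord_inj => k.
by rewrite rmorph0; exact: (x0 (existT _ i k)).
Qed.

Lemma lim_coord_continuous a : continuous (lim_coord a).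
Proof.
move=> x; apply: continuous_comp; first exact: lim_proj_continuous.
exact: coord_continuous.
Qed.

Lemma lim_coord_initial (X : topologicalType) (g : X -> inv_lim C) :
  (forall a, continuous (lim_coord a \o g)) -> continuous g.
Proof.
move=> cg; apply: continuous_lim => i.
have -> : lim_proj i \o g = @psi i \o (phi i \o (lim_proj i \o g)).
  by apply: functional_extensionality_dep => x; rewrite /= phiK.
move=> x; apply: continuous_comp; last exact: psi_continuous.
apply: continuous_lim => k; exact: (cg (existT _ i k)).
Qed.

(** Each compatibility condition involves only two components, on which [y] agrees with an element
    of the limit. For morphisms of [C] this relies on [coord_factor]: a coordinate of the image is
    determined by one coordinate of the source. *)
Lemma lim_coord_complete (y : forall a : component, S (tag a) (tagged a)) :
  (forall n (F : 'I_n -> component), exists r, forall i, lim_coord (F i) r = y (F i)) ->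
  exists r, forall a, lim_coord a r = y a.
Proof.
move=> yF.
have y2 a b : exists r, lim_coord a r = y a /\ lim_coord b r = y b.
  have [r rE] := yF 2%N (fun i => if i == 0 then a else b).
  by exists r; split; [exact: (rE 0)|exact: (rE 1)].
have yc i : exists c : C i, forall k, coord k c = y (existT _ i k).
  apply: (@coord_lift i (fun k => y (existT _ i k))) => k l h.
  by have [r [<- <-]] := y2 (existT _ i l) (existT _ i k); exact: coord_trmap.
pose c i := sval (cid (yc i)).
have cE i k : coord k (c i) = y (existT _ i k) := svalP (cid (yc i)) k.
have [r rE] : exists r : inv_lim C, forall i, lim_proj i r = c i.
  apply: lim_lift => j i f hf; apply: coord_inj => k; rewrite cE.
  pose h : {rmorphism C j -> S i k} :=
    coord k \o rmorphism_of (hom_zmod_morphism hf) (hom_monoid_morphism hf).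
  have [||l lP] := @coord_factor j (S i k) h; first exact: discreteS.
    move=> x; apply: continuous_comp; first exact: (hom_continuous hf).
    exact: coord_continuous.
  have [r [rl rk]] := y2 (existT _ j l) (existT _ i k).
  rewrite -rk /= -(lim_compat r hf); apply/eqP; rewrite -subr_eq0.
  apply/eqP; transitivity (h (c j - lim_proj j r)); first by rewrite rmorphB.
  apply: lP.
  by rewrite (rmorphB (coord l)) cE -rl subrr.
by exists r => -[i k]; rewrite -cE -rE.
Qed.

(** As the exponent may be unbounded in [k], [d] need not be a Drazin inverse of [c] in [C j]; but
    [h] depends on a single coordinate, whose exponent suffices. *)
Lemma coord_drazin j (E : topologicalPzRingType) (h : {rmorphism C j -> E}) c d :
  discrete E -> continuous h ->
  (forall k, drazin (coord k c) (coord k d)) -> drazin (h c) (h d).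
Proof.
move=> dE ch cd; split.
- rewrite -!rmorphM; congr (h _); apply: coord_inj => k.
  by rewrite !rmorphM; have [] := cd k.
- rewrite -!rmorphM; congr (h _); apply: coord_inj => k.
  by rewrite !rmorphM; have [] := cd k.
have [k kP] := coord_factor dE ch; have [_ _ [m hm]] := cd k; exists m.
rewrite -!rmorphXn -rmorphM; apply/eqP; rewrite -subr_eq0 -rmorphB; apply/eqP/kP.
by rewrite rmorphB rmorphM !rmorphXn hm subrr.
Qed.

(** Uniqueness of Drazin inverses makes the coordinatewise choices compatible, first with the
    transition maps and then with the morphisms of [C]. *)
Lemma lim_coord_drazin (x : inv_lim C) :
  (forall i k (u : S i k), exists v, drazin u v) ->
  exists y, forall a, drazin (lim_coord a x) (lim_coord a y).
Proof.
move=> dD; pose v i (k : sys_idx (S i)) := sval (cid (dD i k (coord k (lim_proj i x)))).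
have vP i k : drazin (coord k (lim_proj i x)) (v i k).
  exact: svalP (cid (dD i k (coord k (lim_proj i x)))).
have vc i : exists c : C i, forall k, coord k c = v i k.
  apply: coord_lift => k l h.
  apply: drazin_uniq (vP i k).
  rewrite -(coord_trmap h); pose t : {rmorphism S i l -> S i k} :=
    rmorphism_of (trmap_zmod_morphism h) (trmap_monoid_morphism h).
  exact: (rmorph_drazin t (vP i l)).
pose c i := sval (cid (vc i)).
have cE i k : coord k (c i) = v i k := svalP (cid (vc i)) k.
have [y yE] : exists y : inv_lim C, forall i, lim_proj i y = c i.
  apply: lim_lift => j i f hf; apply: coord_inj => k; rewrite cE.
  pose h : {rmorphism C j -> S i k} :=
    coord k \o rmorphism_of (hom_zmod_morphism hf) (hom_monoid_morphism hf).
  apply: drazin_uniq (vP i k); rewrite -(lim_compat x hf).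
  apply: (@coord_drazin j (S i k) h) => [|y|l]; first exact: discreteS.
    apply: continuous_comp; first exact: (hom_continuous hf).
    exact: coord_continuous.
  by rewrite cE.
exists y => -[i k]; have := vP i k; rewrite -cE -yE; exact.
Qed.

End LimitOfPro.

Theorem corollary5p16 (P : pzRingType -> Prop)
    (hP : P = semiprimary \/ P = right_perfect \/
          P = pi_regular_semiperfect \/ P = pi_regular)
    (C : small_category) (hC : forall i : idx C, pro P (C i)) :
  strictly_pro P (inv_lim C).
Proof.
pose S i := sval (cid (hC i)).
have SP i : [/\ forall k, discrete (S i k), forall k, P (S i k)
    & exists f : {rmorphism C i -> inv_lim (sys_cat (S i))}, top_ring_iso f].
  exact: svalP (cid (hC i)).
have isoS i : exists f : {rmorphism C i -> inv_lim (sys_cat (S i))}, top_ring_iso f.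
  by have [] := SP i.
pose phi i := sval (cid (isoS i)).
have phi_iso i : top_ring_iso (phi i) := svalP (cid (isoS i)).
pose psi i := sval (cid (phi_iso i)).
have psiP i : [/\ cancel (phi i) (psi i), cancel (psi i) (phi i), continuous (phi i)
    & continuous (psi i)] := svalP (cid (phi_iso i)).
have discreteS i k : discrete (S i k) by have [] := SP i.
have PS i k : P (S i k) by have [] := SP i.
have phiK i : cancel (phi i) (psi i) by have [] := psiP i.
have psiK i : cancel (psi i) (phi i) by have [] := psiP i.
have phi_cont i : continuous (phi i) by have [] := psiP i.
have psi_cont i : continuous (psi i) by have [] := psiP i.
apply: (@strictly_pro_drazin_family _ (component S) _ (lim_coord phi)) => //.
- exact: lim_coord_continuous.
- exact: lim_coord_inj phiK.
- move=> X g; exact: lim_coord_initial.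
- exact: lim_coord_complete.
- move=> x; apply: lim_coord_drazin => // i k u.
  by apply: admissible_property_drazin hP _ u; exact: PS.
Qed.
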